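(* (1) If $I$ is an idempotent (two-sided) ideal in a ring $R$, then $\mathrm{fin.dim}(R/I)\le \mathrm{fin.dim}\big(\mathrm{End}_R(R\oplus I)\big)\leq \mathrm{fin.dim}\big(\mathrm{End}_R(_RI)\big)+\mathrm{fin.dim}(R/I)+2.$ (2) Let $0\to Z\to Y\to X\to 0$ be an almost split sequence of $R$-modules with $R$ an Artin algebra. If $\mathrm{Hom}_R(Y,Z)=0$, then $\mathrm{fin.dim}(\mathrm{End}_R(Y\oplus X))\leq \mathrm{fin.dim}(\mathrm{End}_R(Y))+2.$
   Context: Rings are associative with identity; modules are left modules, and $R\oplus I$ is a left $R$-module. An ideal $I$ is idempotent if $I^2=I$. $\mathrm{fin.dim}(A)$ of a ring $A$ is the supremum of the projective dimensions of those left $A$-modules that have a finite projective resolution by finitely generated projective modules. Inequalities are in $\mathbb{N}\cup\{\infty\}$. Endomorphism rings use the convention that $fg$ means first $f$, then $g$ (homomorphisms of left modules are written on the right of their arguments). In (2), the almost split (Auslander-Reiten) sequence is taken in the category of finitely generated left $R$-modules. *)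

(* Defs.v *)
From HB Require Import structures.
From mathcomp Require Import all_boot all_order all_algebra.
From mathcomp Require Import all_classical all_reals.

Set Implicit Arguments.
Unset Strict Implicit.
Unset Printing Implicit Defensive.

Import Order.TTheory GRing.Theory Num.Theory.

Local Open Scope classical_set_scope.
Local Open Scope ring_scope.

(* Rings are pzRingType throughout: the zero ring is allowed, as it must be    *)
(* here (R/I for I = R, End(I) for I = 0).                                     *)

HB.mixin Record isTwoSidedIdeal (R : pzRingType) (S : R -> bool) := {
  two_sided_ideal_mull : forall a, {in S, forall u, a * u \in S};
  two_sided_ideal_mulr : forall a, {in S, forall u, u * a \in S}
}.

#[short(type="twoSidedIdeal")]
HB.structure Definition TwoSidedIdeal (R : pzRingType) :=
  {S of GRing.ZmodClosed R S & isTwoSidedIdeal R S}.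

Definition ideal_mul (R : pzRingType) (I J : twoSidedIdeal R) : set R :=
  [set x | exists n (a b : 'I_n -> R),
    [/\ forall i, a i \in I, forall i, b i \in J & x = \sum_(i < n) a i * b i]].

Definition idempotent_ideal (R : pzRingType) (I : twoSidedIdeal R) : Prop :=
  ideal_mul I I = [set` I].

(* The library only equips {quot I} with a     multiplication when R is          *)
(* commutative and I is proper, hence the alias.                               *)
Definition ring_quot (R : pzRingType) (I : twoSidedIdeal R) : Type := Quotient.quot I.

Section RingQuot.
Context (R : pzRingType) (I : twoSidedIdeal R).
Local Open Scope quotient_scope.
Local Notation Q := (Quotient.quot I).

HB.instance Definition _ := GRing.Zmodule.on (ring_quot I).

Definition ring_quot_mul (x y : ring_quot I) : ring_quot I :=
  \pi_Q (repr (x : Q) * repr (y : Q)).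

Lemma pi_ring_quot_mul (x y : R) :
  ring_quot_mul (\pi_Q x) (\pi_Q y) = \pi_Q (x * y).
Proof.
apply/eqP; rewrite -Quotient.idealrBE.
set x' := repr _; set y' := repr _.
have hx : x' - x \in I by rewrite Quotient.idealrBE /x' /y' reprK eqxx.
have hy : y' - y \in I by rewrite Quotient.idealrBE /x' /y' reprK eqxx.
have -> : x' * y' - x * y = (x' - x) * y' + x * (y' - y).
  by rewrite mulrBl mulrBr addrA addrNK.
by apply: rpredD; [exact: two_sided_ideal_mulr | exact: two_sided_ideal_mull].
Qed.

Let pi1 : ring_quot I := \pi_Q 1.

Let quotP (x : ring_quot I) : exists a : R, x = \pi_Q a.
Proof. by exists (repr (x : Q)); rewrite reprK. Qed.

Let pi_add (x y : R) : (\pi_Q x : ring_quot I) + \pi_Q y = \pi_Q (x + y).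
Proof. by rewrite (@Quotient.pi_add R I). Qed.

Fact ring_quot_mulA : associative ring_quot_mul.
Proof.
move=> x y z; have [[a ->] [b ->] [c ->]] := And3 (quotP x) (quotP y) (quotP z).
by rewrite !pi_ring_quot_mul mulrA.
Qed.

Fact ring_quot_mul1r : left_id pi1 ring_quot_mul.
Proof. by move=> x; have [a ->] := quotP x; rewrite pi_ring_quot_mul mul1r. Qed.

Fact ring_quot_mulr1 : right_id pi1 ring_quot_mul.
Proof. by move=> x; have [a ->] := quotP x; rewrite pi_ring_quot_mul mulr1. Qed.

Fact ring_quot_mulDl : left_distributive ring_quot_mul +%R.
Proof.
move=> x y z; have [[a ->] [b ->] [c ->]] := And3 (quotP x) (quotP y) (quotP z).
by rewrite !(pi_add, pi_ring_quot_mul) mulrDl.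
Qed.

Fact ring_quot_mulDr : right_distributive ring_quot_mul +%R.
Proof.
move=> x y z; have [[a ->] [b ->] [c ->]] := And3 (quotP x) (quotP y) (quotP z).
by rewrite !(pi_add, pi_ring_quot_mul) mulrDr.
Qed.

HB.instance Definition _ := GRing.Zmodule_isPzRing.Build (ring_quot I)
  ring_quot_mulA ring_quot_mul1r ring_quot_mulr1
  ring_quot_mulDl ring_quot_mulDr.

End RingQuot.

Definition ideal_module (R : pzRingType) (I : twoSidedIdeal R) : Type :=
  {x : R^o | x \in I}.

Section IdealModule.
Context (R : pzRingType) (I : twoSidedIdeal R).

Fact ideal_subsemimod_closed :
  GRing.subsemimod_closed (fun x : R^o => x \in I).
Proof.
split; first by split; [exact: rpred0 | move=> x y; exact: rpredD].
by move=> a u; exact: two_sided_ideal_mull.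
Qed.

HB.instance Definition _ := SubChoice.on (ideal_module I).
HB.instance Definition _ :=
  GRing.SubChoice_isSubLmodule.Build R R^o (fun x : R^o => x \in I)
    (ideal_module I) ideal_subsemimod_closed.

End IdealModule.

(* The ring End_R(M).                                                          *)
Definition endo (R : pzRingType) (M : lmodType R) : Type := {linear M -> M}.

Section EndoRing.
Context (R : pzRingType) (M : lmodType R).

HB.instance Definition _ := Choice.on (endo M).

Definition endo_zero : endo M := \0 : {linear M -> M}.
Definition endo_opp (f : endo M) : endo M :=
  (\- (f : {linear M -> M}))%R : {linear M -> M}.
Definition endo_add (f g : endo M) : endo M :=
  ((f : {linear M -> M}) \+ (g : {linear M -> M}))%R : {linear M -> M}.
Definition endo_one : endo M := idfun : {linear M -> M}.
(* Endomorphisms compose from left to right: f * g is f followed by g.         *)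
Definition endo_mul (f g : endo M) : endo M :=
  ((g : {linear M -> M}) \o (f : {linear M -> M})) : {linear M -> M}.

Lemma endo_eq (f g : endo M) :
  (f : {linear M -> M}) =1 (g : {linear M -> M}) -> f = g.
Proof.
case: f g => [f cf] [g cg] /= /funext fg; case: _ / fg in cg *.
case: cf cg => [[f1] [f2]] [[g1] [g2]].
by rewrite (Prop_irrelevance f1 g1) (Prop_irrelevance f2 g2).
Qed.

Fact endo_addA : associative endo_add.
Proof. by move=> f g h; apply: endo_eq => x /=; rewrite addrA. Qed.

Fact endo_addC : commutative endo_add.
Proof. by move=> f g; apply: endo_eq => x /=; rewrite addrC. Qed.

Fact endo_add0 : left_id endo_zero endo_add.
Proof. by move=> f; apply: endo_eq => x /=; rewrite add0r. Qed.

Fact endo_addN : left_inverse endo_zero endo_opp endo_add.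
Proof. by move=> f; apply: endo_eq => x /=; rewrite addNr. Qed.

HB.instance Definition _ :=
  GRing.isZmodule.Build (endo M) endo_addA endo_addC endo_add0 endo_addN.

Fact endo_mulA : associative endo_mul.
Proof. by move=> f g h; apply: endo_eq. Qed.

Fact endo_mul1 : left_id endo_one endo_mul.
Proof. by move=> f; apply: endo_eq. Qed.

Fact endo_1mul : right_id endo_one endo_mul.
Proof. by move=> f; apply: endo_eq. Qed.

Fact endo_mulDl : left_distributive endo_mul +%R.
Proof. by move=> f g h; apply: endo_eq => x; rewrite /= raddfD. Qed.

Fact endo_mulDr : right_distributive endo_mul +%R.
Proof. by move=> f g h; apply: endo_eq. Qed.

HB.instance Definition _ := GRing.Zmodule_isPzRing.Build (endo M)
  endo_mulA endo_mul1 endo_1mul endo_mulDl endo_mulDr.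

End EndoRing.

Section Homological.
Context (A : pzRingType).
Implicit Types M N P : lmodType A.

Definition fin_gen M : Prop :=
  exists n (v : 'I_n -> M),
    forall x, exists a : 'I_n -> A, x = \sum_(i < n) a i *: v i.

Definition projective P : Prop :=
  forall (M N : lmodType A) (g : {linear M -> N}) (f : {linear P -> N}),
    range g = setT -> exists h : {linear P -> M}, forall x, g (h x) = f x.

Definition exact_at (L M N : lmodType A)
  (f : {linear L -> M}) (g : {linear M -> N}) : Prop :=
  range f = g @^-1` [set 0].

(* 0 -> P n -> ... -> P 0 -> M -> 0 exact with all P i in the class C, which   *)
(* is assumed to contain the zero modules.                                     *)
Definition has_resolution (C : lmodType A -> Prop) (n : nat) M : Prop :=
  exists (P : nat -> lmodType A) (d : forall i, {linear P i.+1 -> P i})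
         (e : {linear P 0%N -> M}),
    [/\ forall i, C (P i),
        forall i, (n < i)%N -> forall x : P i, x = 0,
        range e = setT,
        exact_at (d 0%N) e
      & forall i, exact_at (d i.+1) (d i)].

(* \bar int serves as N u {oo}.                                                *)
Definition proj_dim M : \bar int :=
  infimum +oo%E [set n%:Z%:E | n in [set n | has_resolution projective n M]].

Definition has_finite_fg_resolution M : Prop :=
  exists n, has_resolution (fun P => projective P /\ fin_gen P) n M.

Definition fin_dim : \bar int :=
  supremum 0%E [set x | exists2 M, has_finite_fg_resolution M & x = proj_dim M].

End Homological.

Section AlmostSplit.
Context (R : pzRingType).

Definition split_mono (M N : lmodType R) (f : {linear M -> N}) : Prop :=
  exists r : {linear N -> M}, cancel f r.

Definition split_epi (M N : lmodType R) (g : {linear M -> N}) : Prop :=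
  exists s : {linear N -> M}, cancel s g.

Definition left_almost_split (Z Y : lmodType R) (f : {linear Z -> Y}) : Prop :=
  ~ split_mono f /\
  forall (W : lmodType R) (u : {linear Z -> W}), fin_gen W -> ~ split_mono u ->
    exists v : {linear Y -> W}, forall z, v (f z) = u z.

Definition right_almost_split (Y X : lmodType R) (g : {linear Y -> X}) : Prop :=
  ~ split_epi g /\
  forall (W : lmodType R) (u : {linear W -> X}), fin_gen W -> ~ split_epi u ->
    exists v : {linear W -> Y}, forall w, g (v w) = u w.

Definition almost_split_sequence (Z Y X : lmodType R)
  (f : {linear Z -> Y}) (g : {linear Y -> X}) : Prop :=
  [/\ [/\ fin_gen Z, fin_gen Y & fin_gen X],
      [/\ injective f, exact_at f g & range g = setT],
      left_almost_split f
    & right_almost_split g].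

End AlmostSplit.

Definition artinian (k : comPzRingType) : Prop :=
  forall J : nat -> twoSidedIdeal k,
    (forall n, {subset J n.+1 <= J n}) ->
    exists N, forall n, (N <= n)%N -> J n =i J N.

(* The algebra structure is given by its structure morphism phi: the library's *)
(* algType would exclude the zero algebra.                                     *)
Definition artin_algebra (R : pzRingType) : Prop :=
  exists (k : comPzRingType) (phi : {rmorphism k -> R}),
    [/\ artinian k,
        forall a x, GRing.comm (phi a) x
      & exists n (v : 'I_n -> R),
          forall x, exists a : 'I_n -> k, x = \sum_(i < n) phi (a i) * v i].

(* Main.v *)
Require Import Defs.
From HB Require Import structures.
From mathcomp Require Import all_boot all_order all_algebra.
From mathcomp Require Import all_classical all_reals.

Set Implicit Arguments.
Unset Strict Implicit.
Unset Printing Implicit Defensive.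

Import Order.TTheory GRing.Theory Num.Theory.

Local Open Scope classical_set_scope.
Local Open Scope ring_scope.

(** Both parts come from one statement about a ring A, an idempotent e of A and
    the ideal J = AeA, in the case where J is finitely generated projective as a
    left A-module.  With B = A/J and C = eAe,

        fin.dim B <= fin.dim A <= fin.dim C + fin.dim B + 2.

    For an idempotent ideal I of R, let A = End(R + I) for the direct sum R + I,
    and let e be the projection onto I, so that C = End(I).  Every homomorphism
    from I to R has its image in I because I = I^2.  Hence A/AeA = R/I, and each
    element of AeA is uniquely a + b v with a, b in Ae, where v is the inclusion
    of I in R; so AeA is isomorphic to Ae + Ae.

    For an almost split sequence from Z to X through Y, let A = End(Y + X), and
    let e be the projection onto Y.  If X is not a summand of Y, the maps Y -> X
    and the non-split-epic maps X -> X factor through the almost split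
    epimorphism g, and they factor uniquely since Hom(Y, Z) = 0.  So again AeA is
    isomorphic to Ae + Ae, with v = g, and A/AeA is a division ring, of
    finitistic dimension 0.  If X is a summand of Y then AeA = A and A/AeA = 0.

    Projectivity of J is used as a finite dual basis (ideal_dual_basis):
    elements u_t of eA and left linear maps beta_t : J -> Ae such that
    y = sum_t beta_t(y) u_t on J.  A finite dual basis (v_i, s_i) of a
    projective module P then gives the formula

        y = sum_(i, t) beta_t(s_i(y)) u_t v_i    for y in JP,

    from which everything is read off: eP is projective over C
    (corner_fproj), and if K is a submodule of P such that e(P/K) is
    C-projective, then applying a C-linear retraction of eP onto eK to the
    elements u_t v_i shows that JK is A-projective (ideal_part_syzygy).

    The lower bound holds because a B-module M has the same projective dimension
    over A and over B, up to an increase by at most one: B = A/J has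
    dimension at most 1 over A (syz_restr), and conversely a syzygy K -> P -> M
    over A, where eM = 0, reduces to a syzygy K/JK -> P/JP -> M over B whose
    first term is K modulo the projective module JK (syz_descent).

    For the upper bound (syz_bound), let N have a finite f.g. resolution
    over A.  The C-module eN has dimension at most c = fin.dim C, so after c
    syzygies eN becomes projective.  One more syzygy K of N then has JK
    projective, and K/JK is a B-module with a finite f.g. resolution, hence of
    dimension at most b = fin.dim B over B and b + 1 over A.  So K has
    dimension at most b + 1, and N at most c + b + 2. *)

(** * Linear maps, submodules, quotients and change of rings *)

Section Linear.
Context (A : pzRingType) (M N : lmodType A).

Definition to_linear (h : M -> N)
    (hlin : forall a x y, h (a *: x + y) = a *: h x + h y) : {linear M -> N} :=
  HB.pack_for {linear M -> N} h (GRing.isLinear.Build A M N *:%R h hlin).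

Definition submodule (S : set M) : Prop :=
  S 0 /\ forall a x y, S x -> S y -> S (a *: x + y).

Lemma ker_submodule (g : {linear M -> N}) : submodule [set x | g x = 0].
Proof.
by split=> [|a x y /= gx gy]; rewrite /= ?raddf0 // linearP gx gy scaler0 addr0.
Qed.

End Linear.

Section Pairs.
Context (R : pzRingType) (M N : lmodType R).

Fact pair_inl_linear a (x y : M) : ((a *: x + y, 0) : (M * N)%type) = a *: (x, 0) + (y, 0).
Proof. by congr pair; rewrite /= scaler0 addr0. Qed.
Fact pair_inr_linear a (x y : N) : ((0, a *: x + y) : (M * N)%type) = a *: (0, x) + (0, y).
Proof. by congr pair; rewrite /= scaler0 addr0. Qed.

Definition pair_inl : {linear M -> (M * N)%type} := to_linear pair_inl_linear.
Definition pair_inr : {linear N -> (M * N)%type} := to_linear pair_inr_linear.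
Definition pair_fst : {linear (M * N)%type -> M} := fst.
Definition pair_snd : {linear (M * N)%type -> N} := snd.

Lemma pair_decomp (z : (M * N)%type) : z = pair_inl (pair_fst z) + pair_inr (pair_snd z).
Proof. by case: z => x y; congr pair; rewrite /= ?addr0 ?add0r. Qed.

End Pairs.

Section SubModule.
Context (A : pzRingType) (M : lmodType A).

Definition sub_mod (S : set M) (HS : submodule S) : Type := {x : M | `[< S x >]}.

Context (S : set M) (HS : submodule S).

Fact sub_mod_closed : GRing.subsemimod_closed (fun x : M => `[< S x >]).
Proof.
case: HS => S0 SP; split; first split; first exact/asboolP.
- by move=> x y /asboolP Sx /asboolP Sy; apply/asboolP; rewrite -[x]scale1r; exact: SP.
- move=> a x /asboolP Sx; apply/asboolP.
  by rewrite -[_ *: _]addr0; exact: SP.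
Qed.

HB.instance Definition _ := SubChoice.on (sub_mod HS).
HB.instance Definition _ :=
  GRing.SubChoice_isSubLmodule.Build A M (fun x : M => `[< S x >])
    (sub_mod HS) sub_mod_closed.

Definition sub_incl : {linear sub_mod HS -> M} := \val.

Lemma sub_incl_inj : injective sub_incl.
Proof. exact: val_inj. Qed.

Lemma sub_inclP (x : sub_mod HS) : S (sub_incl x).
Proof. by apply/asboolP; exact: (valP x). Qed.

Lemma range_sub_incl : range sub_incl = S.
Proof.
apply/seteqP; split=> [_ [x _ <-]|x Sx]; first exact: sub_inclP.
by exists (exist _ x (introT (asboolP _) Sx)).
Qed.

Lemma sub_lift (x : M) : S x -> exists z, sub_incl z = x.
Proof. by rewrite -{1}range_sub_incl => -[z _ <-]; exists z. Qed.

End SubModule.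

Section Quotient.
Context (A : pzRingType) (M : lmodType A) (S : set M) (HS : submodule S).

Fact sub_zmod_closed : zmod_closed (fun x : M => `[< S x >]).
Proof.
case: HS => S0 SP; split=> [|x y /asboolP Sx /asboolP Sy]; apply/asboolP => //.
by rewrite addrC -scaleN1r; exact: SP.
Qed.

Definition sub_zmod : zmodClosed M := HB.pack_for (zmodClosed M) (fun x : M => `[< S x >])
  (GRing.isZmodClosed.Build M (fun x : M => `[< S x >]) sub_zmod_closed).

End Quotient.

(** M/S is made a module over B, rather than over A, because ker p sends M into
    S.  The hypotheses are arguments of the type so that its B-module structure
    can be inferred. *)
Definition quot_mod (A B : pzRingType) (p : {rmorphism A -> B})
    (psurj : range p = setT) (M : lmodType A) (S : set M) (HS : submodule S)
    (pS : forall a x, p a = 0 -> S (a *: x)) : Type :=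
  Quotient.quot (sub_zmod HS).

Section QuotMod.
Context (A B : pzRingType) (p : {rmorphism A -> B}) (psurj : range p = setT).
Context (M : lmodType A) (S : set M) (HS : submodule S).
Context (pS : forall a x, p a = 0 -> S (a *: x)).

Local Notation Q := (quot_mod psurj HS pS).
Local Notation Q0 := (Quotient.quot (sub_zmod HS)).
Local Open Scope quotient_scope.

HB.instance Definition _ := GRing.Zmodule.on Q.

Definition quot_pi (x : M) : Q := \pi_Q0 x.

Lemma quot_piD x y : quot_pi (x + y) = quot_pi x + quot_pi y.
Proof. by rewrite /quot_pi (Quotient.pi_add (sub_zmod HS)). Qed.

Lemma quot_pi_eq x y : quot_pi x = quot_pi y <-> S (x - y).
Proof.
rewrite /quot_pi; split=> [/eqP|Sxy]; last apply/eqP.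
  by rewrite -Quotient.idealrBE => /asboolP.
by rewrite -Quotient.idealrBE; apply/asboolP.
Qed.

Lemma quot_pi_surj (z : Q) : exists x, quot_pi x = z.
Proof. by exists (repr (z : Q0)); rewrite /quot_pi reprK. Qed.

Let lift (b : B) : exists a, p a = b.
Proof. by have : setT b := I; rewrite -psurj => -[a _ <-]; exists a. Qed.

Definition quot_scale (b : B) (z : Q) : Q :=
  quot_pi (projT1 (cid (lift b)) *: projT1 (cid (quot_pi_surj z))).

Lemma quot_scaleE a x : quot_scale (p a) (quot_pi x) = quot_pi (a *: x).
Proof.
rewrite /quot_scale; case: cid => a' /= pa'; case: cid => x' /= /quot_pi_eq Sx'.
apply/quot_pi_eq; have -> : a' *: x' - a *: x = a *: (x' - x) + (a' - a) *: x'.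
  by rewrite scalerBl scalerBr [RHS]addrC addrA addrNK.
by case: HS => _; apply=> //; apply: pS; rewrite rmorphB /= pa' subrr.
Qed.

Fact quot_scaleA b c z : quot_scale b (quot_scale c z) = quot_scale (b * c) z.
Proof.
have [[a <-] [a' <-] [x <-]] := And3 (lift b) (lift c) (quot_pi_surj z).
by rewrite -rmorphM !quot_scaleE scalerA.
Qed.

Fact quot_scale1 : left_id 1 quot_scale.
Proof.
by move=> z; have [x <-] := quot_pi_surj z; rewrite -(rmorph1 p) quot_scaleE scale1r.
Qed.

Fact quot_scaleDr : right_distributive quot_scale +%R.
Proof.
move=> b z t; have [[a <-] [x <-] [y <-]] := And3 (lift b) (quot_pi_surj z) (quot_pi_surj t).
by rewrite -quot_piD !quot_scaleE scalerDr quot_piD.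
Qed.

Fact quot_scaleDl z : {morph quot_scale^~ z : b c / b + c}.
Proof.
move=> b c; have [[a <-] [a' <-] [x <-]] := And3 (lift b) (lift c) (quot_pi_surj z).
by rewrite -rmorphD !quot_scaleE scalerDl quot_piD.
Qed.

HB.instance Definition _ := GRing.Zmodule_isLmodule.Build B Q
  quot_scaleA quot_scale1 quot_scaleDr quot_scaleDl.

Lemma quot_piZ a x : quot_pi (a *: x) = p a *: quot_pi x.
Proof. by rewrite -quot_scaleE. Qed.

Lemma quot_pi0 x : quot_pi x = 0 <-> S x.
Proof.
have <- : quot_pi 0 = 0 by rewrite -(scale0r 0) quot_piZ rmorph0 scale0r.
by rewrite quot_pi_eq subr0.
Qed.

End QuotMod.

Definition restr (A B : pzRingType) (p : {rmorphism A -> B}) (N : lmodType B) : Type := N.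

Section Restr.
Context (A B : pzRingType) (p : {rmorphism A -> B}) (N : lmodType B).

HB.instance Definition _ := GRing.Zmodule.on (restr p N).

Definition restr_scale (a : A) (x : restr p N) : restr p N := p a *: (x : N).

Fact restr_scaleA a b x : restr_scale a (restr_scale b x) = restr_scale (a * b) x.
Proof. by rewrite /restr_scale scalerA rmorphM. Qed.
Fact restr_scale1 : left_id 1 restr_scale.
Proof. by move=> x; rewrite /restr_scale rmorph1 scale1r. Qed.
Fact restr_scaleDr : right_distributive restr_scale +%R.
Proof. by move=> a x y; rewrite /restr_scale scalerDr. Qed.
Fact restr_scaleDl x : {morph restr_scale^~ x : a b / a + b}.
Proof. by move=> a b; rewrite /restr_scale rmorphD scalerDl. Qed.

HB.instance Definition _ := GRing.Zmodule_isLmodule.Build A (restr p N)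
  restr_scaleA restr_scale1 restr_scaleDr restr_scaleDl.

Lemma restrZ a (x : restr p N) : a *: x = p a *: (x : N) :> N.
Proof. by []. Qed.

End Restr.

(** The image of io is the ring eAe of the idempotent e = io 1.  Working with an
    embedding of C lets the corner be any ring isomorphic to eAe, such as an
    endomorphism ring. *)
Definition corner_embedding (A C : pzRingType) (io : C -> A) : Prop :=
  [/\ forall x y, io (x + y) = io x + io y, forall x y, io (x * y) = io x * io y,
      injective io & forall a, exists x, io x = io 1 * a * io 1].

(** The C-module eM. *)
Definition corner (A C : pzRingType) (io : C -> A) (ioP : corner_embedding io)
  (M : lmodType A) : Type := {x : M | io 1 *: x == x}.

Section Corner.
Context (A C : pzRingType) (io : C -> A) (ioP : corner_embedding io).
Context (M : lmodType A).
Local Notation e := (io 1).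
Local Notation eM := (corner ioP M).

HB.instance Definition _ := SubChoice.on eM.

Fact corner_zmod_closed : zmod_closed (fun x : M => e *: x == x).
Proof.
split=> [|x y /eqP ex /eqP ey]; rewrite unfold_in ?scaler0 //.
by rewrite scalerBr ex ey.
Qed.

HB.instance Definition _ := GRing.SubChoice_isSubZmodule.Build M
  (fun x : M => e *: x == x) eM corner_zmod_closed.

Lemma corner_subproof (c : C) (x : eM) : e *: (io c *: val x) == io c *: val x.
Proof. by case: ioP => _ ioM _ _; rewrite scalerA -ioM mul1r. Qed.

Definition corner_scale (c : C) (x : eM) : eM :=
  exist (fun x : M => e *: x == x) _ (corner_subproof c x).

Fact corner_scaleA a b x : corner_scale a (corner_scale b x) = corner_scale (a * b) x.
Proof. by apply: val_inj; case: ioP => _ ioM _ _; rewrite /= ioM scalerA. Qed.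
Fact corner_scale1 : left_id 1 corner_scale.
Proof. by move=> x; apply: val_inj; rewrite /= (eqP (valP x)). Qed.
Fact corner_scaleDr : right_distributive corner_scale +%R.
Proof. by move=> a x y; apply: val_inj; exact: (scalerDr (io a) (val x) (val y)). Qed.
Fact corner_scaleDl x : {morph corner_scale^~ x : a b / a + b}.
Proof.
move=> a b; apply: val_inj; case: ioP => ioD _ _ _ /=.
by rewrite ioD; exact: (scalerDl (val x) (io a) (io b)).
Qed.

HB.instance Definition _ := GRing.Zmodule_isLmodule.Build C eM
  corner_scaleA corner_scale1 corner_scaleDr corner_scaleDl.

Lemma corner_valP c (x y : eM) : val (c *: x + y) = io c *: val x + val y.
Proof. exact: raddfD. Qed.

Lemma corner_ide (x : eM) : e *: val x = val x.
Proof. exact: (eqP (valP x)). Qed.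

Lemma corner_lift (x : M) : e *: x = x -> exists z : eM, val z = x.
Proof. by move=> /eqP ex; exists (exist (fun x : M => e *: x == x) x ex). Qed.

End Corner.

(** * Short exact sequences and syzygies *)

Section ShortExact.
Context (A : pzRingType).
Implicit Types K L M N P Q : lmodType A.

Definition short_exact L M N (f : {linear L -> M}) (g : {linear M -> N}) : Prop :=
  [/\ injective f, exact_at f g & range g = setT].

Lemma surj_lift (S T : Type) (g : S -> T) : range g = setT -> forall y, exists x, g x = y.
Proof. by move=> gT y; have : setT y := I; rewrite -gT => -[x _ <-]; exists x. Qed.

Lemma lift_surj (S T : Type) (g : S -> T) : (forall y, exists x, g x = y) -> range g = setT.
Proof. by move=> h; apply/seteqP; split=> // y _; have [x <-] := h y; exists x. Qed.

Lemma short_exactP L M N (f : {linear L -> M}) (g : {linear M -> N}) :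
  (forall x, f x = 0 -> x = 0) -> (forall x, g (f x) = 0) ->
  (forall y, g y = 0 -> exists x, f x = y) -> (forall z, exists y, g y = z) ->
  short_exact f g.
Proof.
move=> finj fg gf gsurj; split; last exact: lift_surj.
- by move=> x y fxy; apply/subr0_eq/finj; rewrite raddfB /= fxy subrr.
- apply/seteqP; split=> [_ [x _ <-]|y gy]; first exact: fg.
  by have [x <-] := gf y gy; exists x.
Qed.

Section Facts.
Context (L M N : lmodType A) (f : {linear L -> M}) (g : {linear M -> N}).
Hypothesis fg : short_exact f g.

Lemma short_exact0 x : g (f x) = 0.
Proof.
have [_ fge _] := fg.
have : range f (f x) by exists x.
by rewrite fge.
Qed.

Lemma short_exact_lift y : g y = 0 -> exists x, f x = y.
Proof.
have [_ fge _] := fg; move=> gy.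
have : (g @^-1` [set 0]) y by [].
by rewrite -fge => -[x _ <-]; exists x.
Qed.

Lemma short_exact_inj0 x : f x = 0 -> x = 0.
Proof. by have [finj _ _] := fg; rewrite -(raddf0 f); exact: finj. Qed.

Lemma short_exact_surj z : exists y, g y = z.
Proof. by have [_ _ gT] := fg; exact: surj_lift. Qed.

End Facts.

Lemma ker_short_exact M N (g : {linear M -> N}) :
  range g = setT -> exists K (u : {linear K -> M}), short_exact u g.
Proof.
move=> gT; exists (sub_mod (ker_submodule g)), (sub_incl (ker_submodule g)).
by split=> //; rewrite /exact_at range_sub_incl.
Qed.

Lemma zero_module : exists Z : lmodType A, forall x : Z, x = 0.
Proof.
have [|Z [u uid]] := @ker_short_exact A^o A^o idfun.
  by apply: lift_surj => y; exists y.
by exists Z => x; apply: (short_exact_inj0 uid); exact: (short_exact0 uid x).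
Qed.

Lemma lift_through_mono L M N (i : {linear L -> M}) (h : {linear N -> M}) :
  injective i -> (forall x, exists l, i l = h x) ->
  exists r : {linear N -> L}, forall x, i (r x) = h x.
Proof.
move=> iinj /choice[r ir].
have rlin a x y : r (a *: x + y) = a *: r x + r y.
  by apply: iinj; rewrite linearP /= !ir linearP.
by exists (to_linear rlin).
Qed.

Lemma descend_along_epi L M N (q : {linear M -> N}) (h : {linear M -> L}) :
  range q = setT -> (forall x, q x = 0 -> h x = 0) ->
  exists k : {linear N -> L}, forall x, k (q x) = h x.
Proof.
move=> /surj_lift/choice[s qs] qh.
have hq x y : q x = q y -> h x = h y.
  by move=> qxy; apply/subr0_eq; rewrite -(raddfB h); apply: qh; rewrite raddfB /= qxy subrr.
have klin a x y : h (s (a *: x + y)) = a *: h (s x) + h (s y).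
  by rewrite -linearP; apply: hq; rewrite linearP !qs.
exists (to_linear klin) => x.
by apply: hq; rewrite qs.
Qed.

Lemma pair_mapP L M N (f : {linear L -> N}) (g : {linear M -> N}) :
  exists h : {linear (L * M)%type -> N}, forall x y, h (x, y) = f x + g y.
Proof.
by exists ((f \o pair_fst L M) \+ (g \o pair_snd L M)).
Qed.

Lemma pair_short_exact M N :
  exists (f : {linear M -> (M * N)%type}) (g : {linear (M * N)%type -> N}),
    [/\ short_exact f g, forall x, f x = (x, 0) & forall z, g z = z.2].
Proof.
exists (pair_inl M N), (pair_snd M N); split=> //; apply: short_exactP => //=.
- by move=> x [].
- by move=> [x y] /= ->; exists x.
- by move=> y; exists (0, y).
Qed.

(** Besides the section s, the retraction r is kept: it carries generators and
    liftings from M to L. *)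
Lemma projective_split L M P (i : {linear L -> M}) (q : {linear M -> P}) :
  short_exact i q -> projective P ->
  exists (s : {linear P -> M}) (r : {linear M -> L}),
    [/\ forall x, q (s x) = x, forall x, i (r x) = x - s (q x) & forall x, r (i x) = x].
Proof.
move=> iq projP; have [iinj _ qT] := iq.
have [s qs] := projP _ _ q idfun qT.
have hlin a (x y : M) : a *: x + y - s (q (a *: x + y)) =
    a *: (x - s (q x)) + (y - s (q y)).
  by rewrite (linearP q) (linearP s) opprD addrACA scalerBr.
have [|r ir] := @lift_through_mono L M M i (to_linear hlin) iinj.
  by move=> x; apply: (short_exact_lift iq); rewrite /= raddfB /= qs subrr.
exists s, r; split=> // x; apply: iinj; rewrite ir /=.
by rewrite (short_exact0 iq) raddf0 subr0.
Qed.

(** Third isomorphism theorem, in the form needed to splice resolutions: E is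
    the kernel of q \o a. *)
Lemma comp_short_exact K Q L M N (j : {linear K -> Q}) (a : {linear Q -> M})
    (i : {linear L -> M}) (q : {linear M -> N}) :
  short_exact i q -> short_exact j a ->
  exists (E : lmodType A) (u : {linear E -> Q}) (f : {linear K -> E}) (r : {linear E -> L}),
    short_exact u (q \o a) /\ short_exact f r.
Proof.
move=> iq ja; have [iinj _ _] := iq.
have qaT : range (q \o a) = setT.
  apply: lift_surj => z; have [y <-] := short_exact_surj iq z.
  by have [x <-] := short_exact_surj ja y; exists x.
have [E [u uqa]] := ker_short_exact qaT; have [uinj _ _] := uqa.
have [|r ir] := @lift_through_mono L M _ i (a \o u) iinj.
  by move=> x; apply: (short_exact_lift iq); exact: (short_exact0 uqa x).
have [|f uf] := @lift_through_mono _ Q K u j uinj.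
  by move=> x; apply: (short_exact_lift uqa); rewrite /= (short_exact0 ja) raddf0.
exists E, u, f, r; split=> //.
apply: short_exactP.
- by move=> x fx; apply: (short_exact_inj0 ja); rewrite -uf fx raddf0.
- by move=> x; apply: iinj; rewrite ir /= uf (short_exact0 ja) raddf0.
- move=> y ry; have := ir y; rewrite ry raddf0 => /esym/(short_exact_lift ja)[x jx].
  by exists x; apply: uinj; rewrite uf.
- move=> l; have [x ax] := short_exact_surj ja (i l).
  have [|z uz] := short_exact_lift uqa (y := x); first by rewrite /= ax (short_exact0 iq).
  by exists z; apply: iinj; rewrite ir /= uz.
Qed.

(** X is the fibre product of P and P' over M.  When P and P' are projective both
    sequences through X split, which is Schanuel's lemma. *)
Lemma pullback_short_exact K P K' P' M (i : {linear K -> P}) (q : {linear P -> M})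
    (j : {linear K' -> P'}) (b : {linear P' -> M}) :
  short_exact i q -> short_exact j b ->
  exists X : lmodType A,
    (exists (f : {linear K' -> X}) (g : {linear X -> P}), short_exact f g) /\
    (exists (f : {linear K -> X}) (g : {linear X -> P'}), short_exact f g).
Proof.
move=> iq jb; have [d dE] := pair_mapP q (\- b).
have dT : range d = setT.
  apply: lift_surj => z; have [x <-] := short_exact_surj iq z.
  by exists (x, 0); rewrite dE raddf0 addr0.
have [X [u ud]] := ker_short_exact dT; have [uinj _ _] := ud.
have uP z : q (u z).1 = b (u z).2.
  have := short_exact0 ud z; rewrite [u z]surjective_pairing dE.
  exact: subr0_eq.
have uL x y : q x = b y -> exists z, u z = (x, y).
  by move=> qb; apply: (short_exact_lift ud); rewrite dE qb; exact: subrr.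
exists X; split.
- have [|f uf] := @lift_through_mono _ _ K' u (pair_inr P P' \o j) uinj.
    by move=> x; apply: uL; rewrite raddf0 (short_exact0 jb).
  exists f, (fst \o u); apply: short_exactP.
  + move=> x fx; have /= := uf x; rewrite fx raddf0 => -[/esym].
    exact: (short_exact_inj0 jb).
  + by move=> x; rewrite /= uf.
  + move=> z /= z1; have := uP z; rewrite z1 raddf0 => /esym/(short_exact_lift jb)[x jx].
    by exists x; apply: uinj; rewrite uf /= jx -z1 -surjective_pairing.
  + move=> x; have [y by_] := short_exact_surj jb (q x).
    by have [z uz] := uL x y (esym by_); exists z; rewrite /= uz.
- have [|f uf] := @lift_through_mono _ _ K u (pair_inl P P' \o i) uinj.
    by move=> x; apply: uL; rewrite raddf0 (short_exact0 iq).
  exists f, (snd \o u); apply: short_exactP.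
  + move=> x fx; have /= := uf x; rewrite fx raddf0 => -[/esym].
    exact: (short_exact_inj0 iq).
  + by move=> x; rewrite /= uf.
  + move=> z /= z2; have := uP z; rewrite z2 raddf0 => /(short_exact_lift iq)[x ix].
    by exists x; apply: uinj; rewrite uf /= ix -z2 -surjective_pairing.
  + move=> y; have [x qx] := short_exact_surj iq (b y).
    by have [z uz] := uL x y qx; exists z; rewrite /= uz.
Qed.

(** The closure properties shared by the projective and by the f.g. projective
    modules; the calculus of syzygies below uses nothing else, and so serves both
    kinds of resolution. *)
Record resolving (Cl : lmodType A -> Prop) : Prop := Resolving {
  resolving_projective : forall P, Cl P -> projective P;
  resolving0 : forall Z : lmodType A, (forall x : Z, x = 0) -> Cl Z;
  resolving_ext : forall L M N (f : {linear L -> M}) (g : {linear M -> N}),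
    short_exact f g -> Cl L -> Cl N -> Cl M;
  resolving_ker : forall L M N (f : {linear L -> M}) (g : {linear M -> N}),
    short_exact f g -> Cl M -> Cl N -> Cl L }.

Lemma projective_resolving : resolving (@projective A).
Proof.
split=> //.
- move=> Z Z0 M N g f gT; exists \0 => x /=.
  by rewrite (Z0 x) !raddf0.
- move=> L M N i q iq pL pN X Y g f gT.
  have [s [r [qs ir ri]]] := projective_split iq pN.
  have [h gh] := pL _ _ g (f \o i) gT.
  have [k gk] := pN _ _ g (f \o s) gT.
  exists ((h \o r) \+ (k \o q)) => x /=.
  by rewrite raddfD /= gh gk /= -raddfD /= ir subrK.
- move=> L M N i q iq pM pN X Y g f gT.
  have [s [r [qs ir ri]]] := projective_split iq pN.
  have [h gh] := pM _ _ g (f \o r) gT.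
  by exists (h \o i) => x; rewrite /= gh /= ri.
Qed.

Lemma fin_genP M : fin_gen M <-> exists (T : finType) (v : T -> M),
  forall x, exists a : T -> A, x = \sum_t a t *: v t.
Proof.
split=> [[n [v vP]]|[T [v vP]]]; first by exists 'I_n, v.
exists #|T|, (v \o enum_val) => x; have [a ->] := vP x.
by exists (a \o enum_val); rewrite -(big_enum_val (A := T) (fun t => a t *: v t)).
Qed.

Definition fproj M : Prop := projective M /\ fin_gen M.

Lemma fproj_resolving : resolving fproj.
Proof.
split=> [P []//|Z Z0|L M N i q iq [pL fL] [pN fN]|L M N i q iq [pM fM] [pN fN]].
- split; first exact: (resolving0 projective_resolving).
  by exists 0%N, (fun=> 0) => x; exists (fun=> 0); rewrite big_ord0 (Z0 x).
- split; first exact: (resolving_ext projective_resolving iq).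
  have [s [r [qs ir ri]]] := projective_split iq pN.
  move: fL fN => /fin_genP[S [v vP]] /fin_genP[T [w wP]]; apply/fin_genP.
  exists (S + T)%type, (fun u => match u with inl t => i (v t) | inr t => s (w t) end) => x.
  have [a ra] := vP (r x); have [b qb] := wP (q x).
  exists (fun u => match u with inl t => a t | inr t => b t end).
  rewrite big_sumType /=.
  rewrite -[LHS](subrK (s (q x))) -ir ra qb !linear_sum /=.
  by congr (_ + _); apply: eq_bigr => t _; rewrite linearZ.
- split; first exact: (resolving_ker projective_resolving iq).
  have [s [r [qs ir ri]]] := projective_split iq pN.
  move: fM => [n [v vP]]; exists n, (r \o v) => x; have [a xa] := vP (i x).
  exists a; rewrite -[LHS]ri xa linear_sum /=.
  by apply: eq_bigr => t _; rewrite linearZ.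
Qed.

Section Syzygy.
Context (Cl : lmodType A -> Prop) (HC : resolving Cl).

(** syz n M unrolls a resolution of length n one syzygy at a time, which is the
    form that inductions on the length need. *)
Fixpoint syz (n : nat) M : Prop :=
  if n is n'.+1 then
    exists (K P : lmodType A) (i : {linear K -> P}) (q : {linear P -> M}),
      [/\ Cl P, short_exact i q & syz n' K]
  else Cl M.

Lemma resolving_pair M N : Cl M -> Cl N -> Cl (M * N)%type.
Proof.
by move=> CM CN; have [f [g [fg _ _]]] := pair_short_exact M N; exact: (resolving_ext HC fg).
Qed.

Lemma syzS n M : syz n M -> syz n.+1 M.
Proof.
elim: n M => [|n IHn] M /=.
  move=> CM.
  have [|K [u uid]] := @ker_short_exact M M idfun.
    by apply: lift_surj => y; exists y.
  exists K, M, u, idfun; split=> //; apply: (resolving0 HC) => x.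
  by apply: (short_exact_inj0 uid); exact: (short_exact0 uid x).
by move=> [K [P [i [q [CP iq /IHn SK]]]]]; exists K, P, i, q.
Qed.

Lemma syz_le m n M : (m <= n)%N -> syz m M -> syz n M.
Proof.
move=> /subnK <-; elim: (n - m)%N => // k IHk /IHk; rewrite addSn; exact: syzS.
Qed.

(** Horseshoe lemma: lift the cover Q of N to h : Q -> M; then P * Q covers M, and
    its kernel is an extension of the kernel of Q -> N by that of P -> L. *)
Lemma syz_ext n L M N (i : {linear L -> M}) (q : {linear M -> N}) :
  short_exact i q -> syz n L -> syz n N -> syz n M.
Proof.
elim: n L M N i q => [|n IHn] L M N i q iq; first exact: (resolving_ext HC iq).
move=> [L1 [P [j [a [CP ja SL]]]]] [N1 [Q [k [b [CQ kb SN]]]]].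
have [_ _ qT] := iq; have [h qh] := resolving_projective HC CQ b qT.
have [d dE] := pair_mapP (i \o a) h.
have dT : range d = setT.
  apply: lift_surj => m; have [y by_] := short_exact_surj kb (q m).
  have /(short_exact_lift iq)[l il] : q (m - h y) = 0 by rewrite raddfB /= qh by_ subrr.
  have [x ax] := short_exact_surj ja l.
  by exists (x, y); rewrite dE /= ax il subrK.
have [K [u ud]] := ker_short_exact dT; have [uinj _ _] := ud.
have uP (z : K) : i (a (u z).1) + h (u z).2 = 0.
  by have := short_exact0 ud z; rewrite [u z]surjective_pairing dE.
exists K, (P * Q)%type, u, d; split=> //; first exact: resolving_pair.
have [|f uf] := @lift_through_mono K (P * Q)%type L1 u (pair_inl P Q \o j) uinj.
  by move=> x; apply: (short_exact_lift ud); rewrite /= dE /= (short_exact0 ja) !raddf0 addr0.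
have [kinj _ _] := kb.
have [|g kg] := @lift_through_mono N1 Q K k (snd \o u) kinj.
  move=> z; apply: (short_exact_lift kb); rewrite /= -qh.
  by have /(congr1 q) := uP z; rewrite raddfD /= (short_exact0 iq) raddf0 add0r.
apply: (IHn L1 K N1 f g) => //; apply: short_exactP.
- move=> x fx0; have /= := uf x; rewrite fx0 raddf0 => -[jx].
  by apply: (short_exact_inj0 ja).
- by move=> x; apply: kinj; rewrite kg /= uf raddf0.
- move=> z gz; have := kg z; rewrite gz raddf0 /= => z2.
  have := uP z; rewrite -z2 raddf0 addr0 => /(short_exact_inj0 iq).
  move=> /(short_exact_lift ja)[x jx]; exists x; apply: uinj.
  by rewrite uf /= jx z2 -surjective_pairing.
- move=> y; have /(short_exact_lift iq)[l il] : q (h (k y)) = 0.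
    by rewrite qh (short_exact0 kb).
  have [x ax] := short_exact_surj ja l.
  have [|z uz] := short_exact_lift ud (y := (- x, k y)).
    by rewrite /= dE /= !raddfN /= ax il addNr.
  by exists z; apply: kinj; rewrite kg /= uz.
Qed.

Lemma syz_ker n L M P (i : {linear L -> M}) (q : {linear M -> P}) :
  short_exact i q -> Cl P -> syz n M -> syz n L.
Proof.
case: n => [|n] iq CP; first by move=> CM; exact: (resolving_ker HC iq).
move=> [M1 [Q [j [a [CQ ja SM]]]]].
have [K [u [f [r [uqa fr]]]]] := comp_short_exact iq ja.
by exists M1, K, f, r; split=> //; exact: (resolving_ker HC uqa).
Qed.

(** If P covers Q, then P covers M, and the kernel of P -> M is an extension of K
    by the syzygy of Q. *)
Lemma syz_cone n K Q M (i : {linear K -> Q}) (q : {linear Q -> M}) :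
  short_exact i q -> syz n K -> syz n.+1 Q -> syz n.+1 M.
Proof.
move=> iq SK [Q1 [P [j [a [CP ja SQ]]]]].
have [E [u [f [r [uqa fr]]]]] := comp_short_exact iq ja.
by exists E, P, u, (q \o a); split=> //; exact: (syz_ext fr).
Qed.

(** Any syzygy of M is as good as the one in a shortest resolution: in the fibre
    product X of the two covers, K is the kernel of an epimorphism of X onto a
    module of the class, and X is an extension of P by the other syzygy. *)
Lemma syz_tail n K P M (i : {linear K -> P}) (q : {linear P -> M}) :
  short_exact i q -> Cl P -> syz n.+1 M -> syz n K.
Proof.
move=> iq CP [K' [P' [j [b [CP' jb SK']]]]].
have [X [[f [g fg]] [h [k hk]]]] := pullback_short_exact iq jb.
exact: (syz_ker hk CP' (syz_ext fg SK' (syz_le (leq0n n) CP))).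
Qed.

Lemma has_resolutionP n M : has_resolution Cl n M <-> syz n M.
Proof.
have [Z Z0] := zero_module.
elim: n M => [|n IHn] M; split.
- move=> [P [d [e [CP P0 eT ed _]]]].
  apply: (resolving_ext HC (L := P 0%N) (N := Z) (f := e) (g := \0)) => //.
    apply: short_exactP => //.
    + move=> x ex; have : (e @^-1` [set 0]) x by [].
      by rewrite -ed => -[y _ <-]; rewrite (P0 1%N isT y) raddf0.
    + by move=> y _; exact: surj_lift.
    + by move=> z; exists 0; rewrite raddf0 (Z0 z).
  exact: (resolving0 HC).
- move=> CM; exists (fun i => if i is _.+1 then Z else M).
  exists (fun i => \0), idfun; split.
  + by case=> [//|i]; exact: (resolving0 HC).
  + by case=> [//|i] _ x; exact: Z0.
  + by apply: lift_surj => y; exists y.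
  + apply/seteqP; split=> [_ [x _ <-]//|x /= ->].
    by exists 0.
  + move=> i; apply/seteqP; split=> [_ [x _ <-]//|x _].
    by exists 0 => //; rewrite (Z0 x).
- move=> [P [d [e [CP P0 eT ed dd]]]].
  have [K [u ue]] := ker_short_exact eT; have [uinj _ _] := ue.
  have edP x : e x = 0 <-> exists y, d 0%N y = x.
    split=> [ex|[y <-]].
      have : (e @^-1` [set 0]) x by [].
      by rewrite -ed => -[y _ <-]; exists y.
    have : range (d 0%N) (d 0%N y) by exists y.
    by rewrite ed.
  have [|e1 ue1] := @lift_through_mono K (P 0%N) (P 1%N) u (d 0%N) uinj.
    by move=> x; apply: (short_exact_lift ue); apply/edP; exists x.
  exists K, (P 0%N), u, e; split=> //; apply/IHn.
  exists (fun i => P i.+1), (fun i => d i.+1), e1; split=> //.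
  + by move=> i ni; exact: P0.
  + apply: lift_surj => k; have /edP[y yk] := short_exact0 ue k.
    by exists y; apply: uinj; rewrite ue1.
  + rewrite /exact_at (dd 0%N); apply/seteqP; split=> x /= x0.
      by apply: uinj; rewrite ue1 x0 raddf0.
    by rewrite -ue1 x0 raddf0.
- move=> [K [P [u [q [CP uq /IHn[Q [d [e [CQ Q0 eT ed dd]]]]]]]]].
  pose R i := if i is j.+1 then Q j else P.
  pose dR i : {linear R i.+1 -> R i} :=
    match i return {linear R i.+1 -> R i} with
    | 0%N => (u \o e : {linear Q 0%N -> P}) | j.+1 => d j end.
  exists R, dR, q; split.
  + by case.
  + by case=> [//|i]; exact: Q0.
  + by have [] := uq.
  + apply/seteqP; split=> [_ [x _ <-]|x qx]; first exact: (short_exact0 uq).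
    have [k <-] := short_exact_lift uq qx.
    by have [y <-] := surj_lift eT k; exists y.
  + case=> [|i]; last exact: dd.
    rewrite /exact_at ed; apply/seteqP; split=> x /= x0; first by rewrite x0 raddf0.
    exact: (short_exact_inj0 uq).
Qed.

End Syzygy.

Lemma syz_mono (Cl Cl' : lmodType A -> Prop) n M :
  (forall P, Cl P -> Cl' P) -> syz Cl n M -> syz Cl' n M.
Proof.
move=> CC; elim: n M => [|n IHn] M /=; first exact: CC.
by move=> [K [P [i [q [/CC CP iq /IHn SK]]]]]; exists K, P, i, q.
Qed.

(** A finite f.g. resolution may be truncated at the projective dimension: by
    syz_tail its m-th syzygy is projective, and the next term of the resolution
    maps onto it. *)
Lemma syz_fproj d m M :
  syz fproj d M -> syz (@projective A) m M -> syz fproj m M.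
Proof.
elim: d m M => [|d IHd] m M; first by move=> fM _; exact: (syz_le fproj_resolving (leq0n m)).
move=> [K [P [i [q [fP iq SK]]]]] /=.
case: m => [|m] SM; last first.
  exists K, P, i, q; split=> //; apply: IHd => //.
  by apply: (syz_tail projective_resolving iq _ SM); have [] := fP.
split=> //; have [_ [n [v vP]]] := fP; exists n, (q \o v) => x.
have [y <-] := short_exact_surj iq x; have [a ->] := vP y.
by exists a; rewrite linear_sum; apply: eq_bigr => t _; rewrite linearZ.
Qed.

End ShortExact.

(** * Projective and finitistic dimension *)

Section NatInfty.
Local Open Scope ereal_scope.

Lemma ge0_nat_or_infty (x : \bar int) : 0 <= x -> x = +oo \/ exists n : nat, x = n%:Z%:E.
Proof.
case: x => [z||] //; last by left.
by rewrite lee_fin => z0; right; exists `|z|%N; rewrite gez0_abs.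
Qed.

(** The supremum that defines fin_dim is picked by choice, so one has to exist: it
    is the least natural upper bound, or +oo if there is none. *)
Lemma supremums_ge0 (S : set (\bar int)) :
  S !=set0 -> (forall x, S x -> 0 <= x) -> supremums S !=set0.
Proof.
move=> [s Ss] S0.
have uS u : ubound S u -> u = +oo \/ exists n : nat, u = n%:Z%:E.
  by move=> Su; apply: ge0_nat_or_infty; exact: le_trans (S0 _ Ss) (Su _ Ss).
have [[m Hm]|none] := pselect (exists m : nat, ubound S m%:Z%:E); last first.
  exists +oo; split=> [x _|u Su]; first exact: leey.
  by have [->//|[n un]] := uS u Su; exfalso; apply: none; exists n; rewrite -un.
have ex : exists m : nat, `[< ubound S m%:Z%:E >] by exists m; apply/asboolP.
case: (ex_minnP ex) => k /asboolP Hk kmin; exists k%:Z%:E; split=> // u Su.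
have [->|[n un]] := uS u Su; first exact: leey.
by rewrite un lee_fin lez_nat; apply: kmin; apply/asboolP; rewrite -un.
Qed.

End NatInfty.

Section FinDim.
Context (A : pzRingType).
Implicit Types M : lmodType A.
Local Open Scope ereal_scope.

Lemma proj_dim_le M (n : nat) : proj_dim M <= n%:Z%:E <-> syz (@projective A) n M.
Proof.
rewrite -(has_resolutionP (@projective_resolving A)) /proj_dim.
set S := [set m%:Z%:E | m in _].
have HS k : has_resolution (@projective A) k M -> S k%:Z%:E by exists k.
have [[m Hm]|none] := pselect (exists m, has_resolution (@projective A) m M); last first.
  have -> : S = set0.
    by rewrite -subset0 => x [m Hm _]; apply: none; exists m.
  rewrite /infimum eqxx; split=> // Hn; exfalso; apply: none; by exists n.
have ex : exists m, `[< has_resolution (@projective A) m M >] by exists m; apply/asboolP.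
case: (ex_minnP ex) => k /asboolP Hk kmin.
have -> : infimum +oo S = k%:Z%:E.
  have Sk : S k%:Z%:E by exact: HS.
  rewrite /infimum ifF; last by apply/negP => /eqP S0; rewrite S0 in Sk.
  have kinf : infimums S k%:Z%:E.
    split=> [_ [j Hj <-]|x /(_ _ Sk)//].
    by rewrite lee_fin lez_nat; apply: kmin; apply/asboolP.
  exact: (is_subset1_infimums (xgetPex _ (ex_intro _ _ kinf)) kinf).
rewrite lee_fin lez_nat; split=> [kn|Hn]; last by apply: kmin; apply/asboolP.
have PR := @projective_resolving A.
by apply/(has_resolutionP PR)/(syz_le PR kn)/(has_resolutionP PR).
Qed.

Lemma proj_dim_ge0 M : 0 <= proj_dim M.
Proof.
rewrite /proj_dim; set S := [set m%:Z%:E | m in _].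
have [->|/set0P S0] := eqVneq S set0; first by rewrite /infimum eqxx leey.
rewrite /infimum ifF; last by apply/negP => /eqP Se; case: S0 => x; rewrite Se.
case: xgetP => [y -> [_]|_]; last exact: leey.
by apply=> _ [j _ <-]; rewrite lee_fin lez_nat.
Qed.

Definition proj_dims : set (\bar int) :=
  [set x | exists2 M : lmodType A, has_finite_fg_resolution M & x = proj_dim M].

Lemma supremums_proj_dims : supremums proj_dims (fin_dim A).
Proof.
have FR := @fproj_resolving A; have [Z Z0] := zero_module A.
have SZ : proj_dims (proj_dim Z).
  by exists Z => //; exists 0%N; apply/(has_resolutionP FR); exact: (resolving0 FR).
rewrite /fin_dim -/proj_dims /supremum ifF.
  apply: xgetPex; apply: supremums_ge0; first by exists (proj_dim Z).
  by move=> _ [M _ ->]; exact: proj_dim_ge0.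
by apply/negP => /eqP S0; rewrite S0 in SZ.
Qed.

Lemma proj_dim_le_fin_dim M : has_finite_fg_resolution M -> proj_dim M <= fin_dim A.
Proof.
by move=> HM; have [ub _] := supremums_proj_dims; apply: ub; exists M.
Qed.

Lemma fin_dim_le (x : \bar int) :
  (forall M, has_finite_fg_resolution M -> proj_dim M <= x) -> fin_dim A <= x.
Proof.
by move=> xub; have [_ lub] := supremums_proj_dims; apply: lub => _ [M HM ->]; exact: xub.
Qed.

Lemma fin_dim_ge0 : 0 <= fin_dim A.
Proof.
have FR := @fproj_resolving A; have [Z Z0] := zero_module A.
apply: le_trans (proj_dim_ge0 Z) _; apply: proj_dim_le_fin_dim; exists 0%N.
by apply/(has_resolutionP FR); exact: (resolving0 FR).
Qed.

(** By truncation, bounding the finitistic dimension only involves f.g.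
    resolutions, and those are described by finite dual bases. *)
Lemma fin_dim_leP (n : nat) :
  fin_dim A <= n%:Z%:E <->
  forall d M, syz (@fproj A) d M -> syz (@fproj A) n M.
Proof.
have FR := @fproj_resolving A.
split=> [An d M SM|AH].
  apply: (syz_fproj SM); apply/proj_dim_le; apply: le_trans An.
  by apply: proj_dim_le_fin_dim; exists d; apply/(has_resolutionP FR).
apply: fin_dim_le => M [d /(has_resolutionP FR)/AH SM]; apply/proj_dim_le.
by apply: syz_mono SM => P [].
Qed.

End FinDim.

(** * Finite dual bases *)

Definition dual_basis (A : pzRingType) (P : lmodType A) : Prop :=
  exists (T : finType) (v : T -> P) (s : T -> {linear P -> A^o}),
    forall x, x = \sum_t (s t x : A) *: v t.

Section Evaluation.
Context (A : pzRingType) (M : lmodType A) (T : finType) (v : T -> M).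

Lemma sum_scale_linear a (f g : {ffun T -> A^o}) :
  \sum_t ((a *: f + g) t : A) *: v t =
  a *: (\sum_t (f t : A) *: v t) + \sum_t (g t : A) *: v t.
Proof.
rewrite scaler_sumr -big_split /=; apply: eq_bigr => t _.
by rewrite !ffunE scalerDl scalerA.
Qed.

Definition sum_scale : {linear {ffun T -> A^o} -> M} := to_linear sum_scale_linear.

Lemma coordinate_linear t a (f g : {ffun T -> A^o}) :
  (a *: f + g) t = a *: f t + g t.
Proof. by rewrite !ffunE. Qed.

End Evaluation.

Section DualBasis.
Context (A : pzRingType) (P : lmodType A).

Lemma dual_basis_fproj : dual_basis P <-> fproj P.
Proof.
split=> [[T [v [s sP]]]|[projP /fin_genP[T [v vP]]]].
  split; last by apply/fin_genP; exists T, v => x; exists (fun t => s t x).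
  move=> M N g f gT; have /choice[w gw] := fun t => surj_lift gT (f (v t)).
  have hlin a x y : \sum_t (s t (a *: x + y) : A) *: w t =
      a *: (\sum_t (s t x : A) *: w t) + \sum_t (s t y : A) *: w t.
    rewrite scaler_sumr -big_split /=; apply: eq_bigr => t _.
    by rewrite linearP scalerDl scalerA.
  exists (to_linear hlin) => x /=.
  rewrite linear_sum [in RHS](sP x) linear_sum; apply: eq_bigr => t _.
  by rewrite !linearZ /= gw.
have [|h hP] := projP _ _ (sum_scale v) idfun.
  apply: lift_surj => x; have [a ->] := vP x; exists [ffun t => a t].
  by apply: eq_bigr => t _; rewrite ffunE.
have slin t a x y : h (a *: x + y) t = a *: h x t + h y t.
  by rewrite linearP coordinate_linear.
exists T, v, (fun t => to_linear (slin t)) => x.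
by rewrite -[LHS](hP x).
Qed.

End DualBasis.

(** * Restriction to a quotient ring and to a corner *)

Section RestrMap.
Context (A B : pzRingType) (p : {rmorphism A -> B}) (M N : lmodType B) (f : {linear M -> N}).

Lemma restr_map_linear a (x y : restr p M) :
  (f (a *: x + y) : restr p N) = a *: (f x : restr p N) + f y.
Proof. exact: (linearP f (p a) (x : M) (y : M)). Qed.

Definition restr_map : {linear restr p M -> restr p N} := to_linear restr_map_linear.

End RestrMap.

Lemma restr_short_exact (A B : pzRingType) (p : {rmorphism A -> B}) (L M N : lmodType B)
    (f : {linear L -> M}) (g : {linear M -> N}) :
  short_exact f g -> short_exact (restr_map p f) (restr_map p g).
Proof.
move=> fg; apply: short_exactP.
- exact: (short_exact_inj0 fg).
- exact: (short_exact0 fg).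
- by move=> y; exact: (short_exact_lift fg).
- exact: (short_exact_surj fg).
Qed.

Section CornerMap.
Context (A C : pzRingType) (io : C -> A) (ioP : corner_embedding io).

Lemma corner_map_ex (M N : lmodType A) (f : {linear M -> N}) :
  exists h : {linear corner ioP M -> corner ioP N}, forall x, val (h x) = f (val x).
Proof.
have fe (x : corner ioP M) : exists y : corner ioP N, val y = f (val x).
  by apply: corner_lift; rewrite -linearZ corner_ide.
have [h hP] := choice fe.
have hlin c x y : h (c *: x + y) = c *: h x + h y.
  by apply: val_inj; rewrite corner_valP !hP corner_valP linearP.
by exists (to_linear hlin).
Qed.

Lemma corner_short_exact (L M N : lmodType A) (f : {linear L -> M}) (g : {linear M -> N}) :
  short_exact f g ->
  exists (f' : {linear corner ioP L -> corner ioP M})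
      (g' : {linear corner ioP M -> corner ioP N}),
    short_exact f' g' /\ forall x, val (f' x) = f (val x).
Proof.
move=> fg; have [finj _ _] := fg.
have [f' f'P] := corner_map_ex f; have [g' g'P] := corner_map_ex g.
exists f', g'; split=> //; apply: short_exactP.
- move=> x fx; apply: val_inj; apply: finj.
  by rewrite -f'P fx !raddf0.
- by move=> x; apply: val_inj; rewrite g'P f'P (short_exact0 fg) raddf0.
- move=> y gy; have := g'P y; rewrite gy raddf0 => /esym/(short_exact_lift fg)[x fx].
  have [|z zx] := @corner_lift _ _ _ ioP _ x.
    by apply: finj; rewrite linearZ /= fx corner_ide.
  by exists z; apply: val_inj; rewrite f'P zx.
- move=> z; have [y gy] := short_exact_surj fg (val z).
  have ee : io 1 * io 1 = io 1 by case: ioP => _ <-; rewrite mulr1.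
  have [|w wy] := @corner_lift _ _ _ ioP _ (io 1 *: y); first by rewrite scalerA ee.
  by exists w; apply: val_inj; rewrite g'P wy linearZ /= gy corner_ide.
Qed.

End CornerMap.

(** * Idempotent ideals that are projective as left modules *)

(** A finite dual basis of the left ideal J = ker p, with elements u_t in eA and
    functionals beta_t : J -> Ae; the values of beta_t outside J are arbitrary.
    The conditions on u and beta make the last one put J inside AeA. *)
Definition ideal_dual_basis (A B : pzRingType) (p : A -> B) (e : A) : Prop :=
  exists (T : finType) (u : T -> A) (beta : T -> A -> A),
    [/\ forall t, e * u t = u t,
        forall t y, p y = 0 -> beta t y * e = beta t y,
        forall t a x y, p x = 0 -> p y = 0 ->
          beta t (a * x + y) = a * beta t x + beta t y
      & forall y, p y = 0 -> y = \sum_t beta t y * u t].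

(** The submodule AeM generated by eM, defined as an intersection so that its
    elements need not be written as sums: linear identities on AeM follow from
    their case on eM (generated_min). *)
Definition generated (A : pzRingType) (e : A) (M : lmodType A) : set M :=
  [set x | forall S : set M, submodule S -> (forall y, e *: y = y -> S y) -> S x].

Lemma generated_submodule (A : pzRingType) (e : A) (M : lmodType A) :
  submodule (generated e (M := M)).
Proof.
split=> [S [S0 _] _ //|a x y Jx Jy S SP Se].
by case: (SP) => _; apply; [exact: Jx | exact: Jy].
Qed.

Lemma generated_e (A : pzRingType) (e : A) (M : lmodType A) (y : M) :
  e *: y = y -> generated e y.
Proof. by move=> ey S _; exact. Qed.

Lemma generated_min (A : pzRingType) (e : A) (M : lmodType A) (S : set M) :
  submodule S -> (forall y, e *: y = y -> S y) -> generated e (M := M) `<=` S.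
Proof. by move=> SP Se x; apply. Qed.

Section IdempotentIdeal.
Context (A B C : pzRingType) (p : {rmorphism A -> B}) (io : C -> A).
Context (psurj : range p = setT) (ioP : corner_embedding io).
Local Notation e := (io 1).
Context (pe : p e = 0) (T : finType) (u : T -> A) (beta : T -> A -> A).
Context (eu : forall t, e * u t = u t).
Context (betae : forall t y, p y = 0 -> beta t y * e = beta t y).
Context (betaP : forall t a x y, p x = 0 -> p y = 0 ->
          beta t (a * x + y) = a * beta t x + beta t y).
Context (betaK : forall y, p y = 0 -> y = \sum_t beta t y * u t).

Lemma beta0 t : beta t 0 = 0.
Proof.
have p0 : p 0 = 0 by exact: rmorph0.
have := betaP t 1 p0 p0; rewrite mulr0 addr0 mul1r => /esym/(canRL (addrK _)).
by rewrite subrr.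
Qed.

(** On eA the functionals take values in eAe, since they commute with left
    multiplication by e. *)
Lemma beta_corner t y : e * y = y -> exists c, io c = beta t y.
Proof.
move=> ey; have py : p y = 0 by rewrite -ey rmorphM /= pe mul0r.
have [_ _ _ /(_ (beta t y))[c cE]] := ioP; exists c.
by rewrite cE -mulrA betae // -[in RHS]ey -[e * y]addr0 betaP // ?rmorph0 // beta0 addr0.
Qed.

Lemma generated_ker (M : lmodType A) a (x : M) : p a = 0 -> generated e (a *: x).
Proof.
move=> pa S SP Se; rewrite (betaK pa) scaler_suml.
have [S0 SD] := SP.
elim/big_ind: _ => // [y z Sy Sz|t _]; first by rewrite -[y]scale1r; exact: SD.
rewrite -scalerA -[_ *: _]addr0; apply: SD => //; apply: Se.
by rewrite scalerA eu.
Qed.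

Local Notation ideal_part M := (sub_mod (generated_submodule e M)).
Local Notation Q M := (quot_mod psurj (generated_submodule e M) (@generated_ker M)).

Section CornerBasis.
Context (P : lmodType A) (I : finType) (v : I -> P) (s : I -> {linear P -> A^o}).
Context (sK : forall x, x = \sum_i (s i x : A) *: v i).

(** Expand x in eP on the v_i, then each coordinate s_i(x), which lies in eA, on
    the u_t. *)
Lemma corner_expansion : exists (U : I * T -> corner ioP P)
    (g : I * T -> {linear corner ioP P -> C^o}),
  [/\ forall k, val (U k) = u k.2 *: v k.1,
      forall k x, io (g k x) = beta k.2 (s k.1 (val x) : A)
    & forall x, x = \sum_k (g k x : C) *: U k].
Proof.
have [ioD ioM ioI _] := ioP.
have /choice[U UP] (k : I * T) : exists U : corner ioP P, val U = u k.2 *: v k.1.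
  by apply: corner_lift; rewrite scalerA eu.
have se i (x : corner ioP P) : e * (s i (val x) : A) = s i (val x).
  by rewrite -[in RHS](corner_ide x) linearZ.
have ps i (x : corner ioP P) : p (s i (val x)) = 0.
  by rewrite -se rmorphM /= pe mul0r.
have /choice[g gP] (k : I * T) : exists g : corner ioP P -> C,
    forall x, io (g x) = beta k.2 (s k.1 (val x) : A).
  have /choice[g gP] (x : corner ioP P) : exists c, io c = beta k.2 (s k.1 (val x) : A).
    by apply: beta_corner; exact: se.
  by exists g.
have glin k a x y : (g k (a *: x + y) : C^o) = a *: (g k x : C^o) + g k y.
  apply: ioI; rewrite ioD ioM !gP corner_valP linearP.
  by rewrite betaP.
exists U, (fun k => to_linear (glin k)); split=> // x.
apply: val_inj; rewrite raddf_sum /= [LHS]sK.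
transitivity (\sum_i \sum_t beta t (s i (val x) : A) *: (u t *: v i)).
  apply: eq_bigr => i _; rewrite {1}(betaK (ps i x)) scaler_suml.
  by apply: eq_bigr => t _; rewrite scalerA.
by rewrite pair_bigA /=; apply: eq_bigr => k _; rewrite gP UP.
Qed.

End CornerBasis.

Lemma corner_fproj (P : lmodType A) : fproj P -> fproj (corner ioP P).
Proof.
move=> /dual_basis_fproj[I [v [s sK]]]; apply/dual_basis_fproj.
have [U [g [_ _ gK]]] := corner_expansion sK.
by exists (I * T)%type, U, g.
Qed.

(** For K a submodule of P such that eK is a C-linear retract of eP: the elements
    r(u_t v_i) and the maps beta_t o s_i form a dual basis of JK.  The expansion
    is A-linear on JK, and on eK it is the image under r of the
    expansion in eP. *)
Lemma ideal_part_fproj (K P : lmodType A) (k : {linear K -> P})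
    (k' : {linear corner ioP K -> corner ioP P})
    (r : {linear corner ioP P -> corner ioP K}) :
  (forall x, val (k' x) = k (val x)) -> (forall x, r (k' x) = x) ->
  fproj P -> fproj (ideal_part K).
Proof.
move=> k'E rk' /dual_basis_fproj[I [v [s sK]]]; apply/dual_basis_fproj.
have [U [g [UE gE gK]]] := corner_expansion sK.
have /choice[w wE] (j : I * T) : exists w : ideal_part K, sub_incl _ w = val (r (U j)).
  by apply: sub_lift; apply: generated_e; exact: corner_ide.
pose S := [set y : K | (forall i, p (s i (k y)) = 0) /\
  y = \sum_j beta j.2 (s j.1 (k y) : A) *: val (r (U j))].
have S_sub : submodule S.
  split=> [|a x y [px xE] [py yE]]; split.
  - by move=> i; rewrite !raddf0.
  - by rewrite big1 // => j _; rewrite !raddf0 beta0 scale0r.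
  - move=> i; have -> : p (s i (k (a *: x + y))) = p a * p (s i (k x)) + p (s i (k y)).
      by rewrite !linearP -rmorphM -rmorphD.
    by rewrite px py mulr0 addr0.
  - rewrite {1}xE {1}yE scaler_sumr -big_split; apply: eq_bigr => j _ /=.
    by rewrite !linearP betaP // scalerDl scalerA.
have S_e y : e *: y = y -> S y.
  move=> ey; have [Y <-] := corner_lift ioP ey; split=> [i|].
    by rewrite -(corner_ide Y) !linearZ [LHS]rmorphM /= pe mul0r.
  rewrite -{1}(rk' Y) {1}(gK (k' Y)) linear_sum raddf_sum.
  by apply: eq_bigr => j _; rewrite linearZ /= gE k'E.
have ps (y : ideal_part K) : S (sub_incl _ y).
  by apply: (generated_min S_sub S_e); exact: sub_inclP.
have glin j a (x y : ideal_part K) :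
    (beta j.2 (s j.1 (k (sub_incl _ (a *: x + y)))) : A^o) =
    a *: (beta j.2 (s j.1 (k (sub_incl _ x))) : A^o) + beta j.2 (s j.1 (k (sub_incl _ y))).
  have [px _] := ps x; have [py _] := ps y.
  by rewrite !linearP betaP.
exists (I * T)%type, w, (fun j => to_linear (glin j)) => x.
apply: (@sub_incl_inj _ _ _ (generated_submodule e K)).
have [_ {1}->] := ps x; rewrite linear_sum; apply: eq_bigr => j _.
by rewrite linearZ wE.
Qed.

Lemma quot_proj_linear (M : lmodType A) a (x y : M) :
  (quot_pi psurj (generated_submodule e M) (@generated_ker M) (a *: x + y) : restr p (Q M)) =
  a *: (quot_pi psurj (generated_submodule e M) (@generated_ker M) x : restr p (Q M)) +
  quot_pi psurj (generated_submodule e M) (@generated_ker M) y.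
Proof. by rewrite quot_piD quot_piZ. Qed.

Definition quot_proj (M : lmodType A) : {linear M -> restr p (Q M)} :=
  to_linear (@quot_proj_linear M).

Lemma quot_proj0 (M : lmodType A) (x : M) : quot_proj M x = 0 <-> generated e x.
Proof. exact: quot_pi0. Qed.

Lemma quot_short_exact (M : lmodType A) :
  short_exact (sub_incl (generated_submodule e M)) (quot_proj M).
Proof.
apply: short_exactP.
- by move=> x x0; apply: (@sub_incl_inj _ _ _ (generated_submodule e M)); rewrite x0 raddf0.
- by move=> x; apply/quot_proj0; exact: sub_inclP.
- by move=> y /quot_proj0/(sub_lift (generated_submodule e M)).
- exact: quot_pi_surj.
Qed.

(** On eM one has h(x) = h(e x) = p(e) h(x) = 0. *)
Lemma restr_generated (M : lmodType A) (N : lmodType B) (h : {linear M -> restr p N}) x :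
  generated e x -> h x = 0.
Proof.
apply: (generated_min (ker_submodule h)) => y ey /=.
by rewrite -ey linearZ; rewrite [LHS](restrZ e (h y)) pe scale0r.
Qed.

Lemma quot_factor (M : lmodType A) (N : lmodType B) (h : {linear M -> restr p N}) :
  exists k : {linear Q M -> N}, forall x, k (quot_proj M x) = h x.
Proof.
have [_ _ qT] := quot_short_exact M.
have [|k0 k0P] := @descend_along_epi A (restr p N) M (restr p (Q M)) (quot_proj M) h qT.
  by move=> x /quot_proj0; exact: restr_generated.
have klin b (x y : Q M) : (k0 (b *: x + y) : N) = b *: (k0 x : N) + k0 y.
  have [a <-] := surj_lift psurj b.
  exact: (linearP k0 a (x : restr p (Q M)) (y : restr p (Q M))).
by exists (to_linear klin).
Qed.

Lemma quot_fproj (P : lmodType A) : fproj P -> fproj (Q P).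
Proof.
move=> /dual_basis_fproj[I [v [s sK]]]; apply/dual_basis_fproj.
have hlin i a (x y : P) :
    (p (s i (a *: x + y)) : restr p B^o) = a *: (p (s i x) : restr p B^o) + p (s i y).
  by rewrite linearP restrZ -[p a *: _]rmorphM -rmorphD.
have /choice[g gP] i := quot_factor (to_linear (hlin i)).
exists I, (fun i => quot_proj P (v i)), g => z.
have [x <-] := short_exact_surj (quot_short_exact P) z.
rewrite {1}(sK x) linear_sum; apply: eq_bigr => i _.
by rewrite linearZ gP.
Qed.

Lemma restr_fproj_descent (M : lmodType B) : fproj (restr p M) -> fproj M.
Proof.
move=> /dual_basis_fproj[I [v [s sK]]]; apply/dual_basis_fproj.
have hlin i b (x y : M) :
    (p (s i (b *: x + y)) : B^o) = b *: (p (s i x) : B^o) + p (s i y).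
  have [a <-] := surj_lift psurj b.
  have -> : s i (p a *: x + y) = a * s i x + s i y.
    exact: (linearP (s i) a (x : restr p M) (y : restr p M)).
  by rewrite rmorphD rmorphM.
exists I, v, (fun i => to_linear (hlin i)) => x.
by rewrite [LHS](sK x).
Qed.

(** The map K/JK -> P/JP is injective because e M = 0: every element of eP lies
    in K, hence in eK, so that JP = JK. *)
Lemma quot_syzygy (K P : lmodType A) (M : lmodType B)
    (i : {linear K -> P}) (q : {linear P -> restr p M}) :
  short_exact i q ->
  exists (i' : {linear Q K -> Q P}) (q' : {linear Q P -> M}), short_exact i' q'.
Proof.
move=> iq; have [iinj _ _] := iq.
have [i' i'P] := quot_factor (quot_proj P \o i).
have [q' q'P] := quot_factor q.
exists i', q'; apply: short_exactP.
- move=> z; have [x <-] := short_exact_surj (quot_short_exact K) z.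
  rewrite i'P => /quot_proj0 Jix; apply/quot_proj0.
  suff : [set y | exists2 x : K, generated e x & i x = y] (i x).
    by case=> x' Jx' /iinj <-.
  move: Jix; apply: generated_min => [|y ey].
    have [J0 JD] := generated_submodule e K.
    split=> [|a _ _ [x1 J1 <-] [x2 J2 <-]]; first by exists 0; rewrite ?raddf0.
    by exists (a *: x1 + x2); [exact: JD | rewrite linearP].
  have [|y' iy'] := short_exact_lift iq (y := y).
    by apply: restr_generated; exact: generated_e.
  exists y' => //; apply: generated_e; apply: iinj.
  by rewrite linearZ /= iy'.
- move=> z; have [x <-] := short_exact_surj (quot_short_exact K) z.
  by rewrite i'P q'P (short_exact0 iq).
- move=> z; have [x <-] := short_exact_surj (quot_short_exact P) z.
  rewrite q'P => /(short_exact_lift iq)[y <-].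
  by exists (quot_proj K y); rewrite i'P.
- move=> z; have [x <-] := short_exact_surj iq z.
  by exists (quot_proj P x); rewrite q'P.
Qed.

(** A splitting of eK -> eP -> eN provides the retraction of eP onto eK. *)
Lemma ideal_part_syzygy (K P N : lmodType A) (i : {linear K -> P}) (q : {linear P -> N}) :
  short_exact i q -> fproj P -> projective (corner ioP N) -> fproj (ideal_part K).
Proof.
move=> iq fP projN.
have [i' [q' [iq' i'E]]] := corner_short_exact ioP iq.
have [_ [r [_ _ ri]]] := projective_split iq' projN.
exact: (ideal_part_fproj i'E ri fP).
Qed.

Lemma corner_restr0 (M : lmodType B) (x : corner ioP (restr p M)) : x = 0.
Proof.
apply: val_inj; rewrite -(corner_ide x) [LHS](restrZ e (val x)) pe.
exact: (scale0r (val x : M)).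
Qed.

Lemma syz_quot n K : fproj (ideal_part K) -> syz (@fproj A) n.+1 K ->
  syz (@fproj A) n.+1 (restr p (Q K)).
Proof.
move=> fJ SK; apply: (syz_cone (@fproj_resolving A) (quot_short_exact K) _ SK).
exact: (syz_le (@fproj_resolving A) (leq0n n) fJ).
Qed.

(** The syzygy K/JK over B of quot_syzygy is, as an A-module, the cokernel of
    JK -> K with JK projective, so that its dimension over A is at most that of K,
    or 1. *)
Lemma syz_descent n (M : lmodType B) :
  syz (@fproj A) n (restr p M) -> syz (@fproj B) n M.
Proof.
elim: n M => [|n IHn] M; first exact: restr_fproj_descent.
move=> [K [P [i [q [fP iq SK]]]]].
have [i' [q' iq']] := quot_syzygy iq.
exists (Q K), (Q P), i', q'; split=> //; first exact: quot_fproj.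
have fJ : fproj (ideal_part K).
  apply: (ideal_part_syzygy iq fP).
  by apply: (resolving0 (@projective_resolving C)); exact: corner_restr0.
case: n SK IHn => [|n] SK IHn; first exact: quot_fproj.
by apply: IHn; exact: syz_quot.
Qed.

(** Cover M by the free module F on its dual basis (v_i, s_i), and lift the
    idempotent matrix s_j(v_i) over B to a matrix t over A.  Each f in the kernel
    is f (1 - t) + f t, where the rows of 1 - t lie in the kernel and the
    coordinates h_j of f t lie in J, so that the u_c account for f t. *)
Lemma restr_fproj (M : lmodType B) : fproj M -> syz (@fproj A) 1 (restr p M).
Proof.
move=> /dual_basis_fproj[I [v [s sK]]].
pose F : lmodType A := {ffun I -> A^o}.
pose qf (f : F) : M := \sum_i p (f i : A) *: v i.
have qlin a (f g : F) :
    (qf (a *: f + g) : restr p M) = a *: (qf f : restr p M) + qf g.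
  rewrite restrZ /qf scaler_sumr -big_split; apply: eq_bigr => i _ /=.
  by rewrite scalerA -(rmorphM p) -scalerDl !ffunE.
pose q : {linear F -> restr p M} := to_linear qlin.
have qT : range q = setT.
  apply: lift_surj => x.
  have /choice[f fE] i := surj_lift psurj (s i x).
  exists [ffun i => f i]; rewrite [RHS](sK x); apply: eq_bigr => i _.
  by rewrite ffunE fE.
have [K [k kq]] := ker_short_exact qT; have [kinj _ _] := kq.
exists K, F, k, q; split=> //.
  apply/dual_basis_fproj; exists I, (fun i => [ffun j => (i == j)%:R]).
  exists (fun i => to_linear (coordinate_linear i)) => f.
  apply/ffunP => j; rewrite sum_ffunE (bigD1 j) //= big1 => [|i ij].
    by rewrite addr0 !ffunE eqxx [RHS]mulr1.
  by rewrite !ffunE (negbTE ij) [LHS]mulr0.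
apply/dual_basis_fproj.
have /choice[t tE] (ij : I * I) := surj_lift psurj (s ij.2 (v ij.1)).
have qf0 (x : K) : qf (k x) = 0 by exact: (short_exact0 kq x).
pose h j (x : K) : A := \sum_i (k x i : A) * t (i, j).
have ph j x : p (h j x) = 0.
  transitivity (s j (qf (k x)) : B); last by rewrite qf0 raddf0.
  rewrite rmorph_sum /qf linear_sum; apply: eq_bigr => i _.
  by rewrite rmorphM linearZ /= tE.
have hlin j a x y : h j (a *: x + y) = a * h j x + h j y.
  rewrite /h mulr_sumr -big_split; apply: eq_bigr => i _ /=.
  by rewrite linearP !ffunE mulrDl -mulrA.
have qrow i : qf [ffun j => (i == j)%:R - t (i, j)] = 0.
  transitivity (\sum_j (i == j)%:R *: v j - \sum_j (s j (v i) : B) *: v j).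
    rewrite -sumrB; apply: eq_bigr => j _.
    by rewrite ffunE rmorphB /= tE scalerBl rmorph_nat.
  rewrite -(sK (v i)) (bigD1 i) //= big1 => [|j ji].
    by rewrite addr0 eqxx scale1r subrr.
  by rewrite eq_sym (negbTE ji) scale0r.
have qideal jc : qf [ffun j => u jc.2 * (j == jc.1)%:R] = 0.
  rewrite /qf big1 // => j _.
  by rewrite ffunE -eu !rmorphM /= pe !mul0r scale0r.
have /choice[row rowE] i := short_exact_lift kq (qrow i).
have /choice[ker kerE] (jc : I * T) := short_exact_lift kq (qideal jc).
have rlin i a x y : k (a *: x + y) i = a *: (k x i) + k y i.
  by rewrite linearP coordinate_linear.
have klin jc a x y : (beta jc.2 (h jc.1 (a *: x + y)) : A^o) =
    a *: (beta jc.2 (h jc.1 x) : A^o) + beta jc.2 (h jc.1 y).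
  by rewrite hlin betaP.
exists (I + I * T)%type, (fun z => match z with inl i => row i | inr jc => ker jc end).
exists (fun z => match z with
  inl i => to_linear (rlin i) | inr jc => to_linear (klin jc) end) => x.
apply: kinj; rewrite big_sumType /= linearD; rewrite !linear_sum /=; apply/ffunP => j.
transitivity ((k x j - h j x) + h j x : A); first by rewrite subrK.
rewrite ffunE !sum_ffunE; congr (_ + _).
  transitivity (\sum_i (k x i : A) * ((i == j)%:R - t (i, j))).
    under eq_bigr do rewrite mulrBr.
    rewrite sumrB (bigD1 j) //= big1 => [|i ij]; last by rewrite (negbTE ij) mulr0.
    by rewrite addr0 eqxx mulr1.
  by apply: eq_bigr => i _; rewrite linearZ /= rowE !ffunE.
transitivity (\sum_i \sum_c beta c (h i x) * (u c * (j == i)%:R)).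
  rewrite (bigD1 j) //= [X in _ + X]big1 => [|i ij]; last first.
    by apply: big1 => c _; rewrite eq_sym (negbTE ij) !mulr0.
  rewrite addr0 {1}(betaK (ph j x)).
  by apply: eq_bigr => c _; rewrite eqxx mulr1.
rewrite pair_bigA /=; apply: eq_bigr => jc _.
by rewrite linearZ /= kerE !ffunE.
Qed.

Lemma syz_restr n (M : lmodType B) :
  syz (@fproj B) n M -> syz (@fproj A) n.+1 (restr p M).
Proof.
have FR := @fproj_resolving A.
elim: n M => [|n IHn] M; first exact: restr_fproj.
move=> [K [P [i [q [fP iq /IHn SK]]]]].
apply: (syz_cone FR (restr_short_exact p iq) SK).
exact: (syz_le FR _ (restr_fproj fP)).
Qed.

Lemma syz_corner n (N : lmodType A) :
  syz (@fproj A) n N -> syz (@fproj C) n (corner ioP N).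
Proof.
elim: n N => [|n IHn] N; first exact: corner_fproj.
move=> [K [P [i [q [fP iq /IHn SK]]]]].
have [i' [q' [iq' _]]] := corner_short_exact ioP iq.
by exists (corner ioP K), (corner ioP P), i', q'; split=> //; exact: corner_fproj.
Qed.

(** Induction on c, replacing N by a syzygy until e N is projective. *)
Lemma syz_bound (b c d : nat) (N : lmodType A) :
  (forall d' M, syz (@fproj B) d' M -> syz (@fproj B) b M) ->
  syz (@fproj A) d N -> syz (@fproj C) c (corner ioP N) ->
  syz (@fproj A) (c + b + 2) N.
Proof.
have FR := @fproj_resolving A; have FC := @fproj_resolving C => Bb.
elim: c d N => [|c IHc] [|d] N.
- by move=> fN _; exact: (syz_le FR (leq0n _) fN).
- move=> [K [P [i [q [fP iq SK]]]]] [projN _]; rewrite add0n addn2.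
  exists K, P, i, q; split=> //.
  have fJ := ideal_part_syzygy iq fP projN.
  apply: (syz_ext FR (quot_short_exact K)); first exact: (syz_le FR (leq0n _) fJ).
  apply: syz_restr; apply: (Bb d.+1); apply: syz_descent; apply: syz_quot => //.
  exact: (syzS FR).
- by move=> fN _; exact: (syz_le FR (leq0n _) fN).
- move=> [K [P [i [q [fP iq SK]]]]] SeN; rewrite !addSn.
  exists K, P, i, q; split=> //; apply: (IHc d) => //.
  have [i' [q' [iq' _]]] := corner_short_exact ioP iq.
  exact: (syz_tail FC iq' (corner_fproj fP) SeN).
Qed.

End IdempotentIdeal.

(** * The two bounds *)

Section Bounds.
Context (A B C : pzRingType) (p : {rmorphism A -> B}) (io : C -> A).
Hypotheses (psurj : range p = setT) (ioP : corner_embedding io) (pe : p (io 1) = 0).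
Hypothesis dualJ : ideal_dual_basis p (io 1).
Local Open Scope ereal_scope.

Theorem fin_dim_quotient_le : fin_dim B <= fin_dim A.
Proof.
have [T [u [beta [eu betae betaP betaK]]]] := dualJ.
have [->|[n An]] := ge0_nat_or_infty (fin_dim_ge0 A); first exact: leey.
rewrite An; apply/fin_dim_leP => d M SM.
apply: (syz_descent psurj ioP pe eu betae betaP betaK).
have An' : fin_dim A <= n%:Z%:E by rewrite An.
have /fin_dim_leP/(_ d.+1) := An'; apply.
exact: (syz_restr psurj pe eu betaP betaK SM).
Qed.

Theorem fin_dim_le_corner_quotient : fin_dim A <= fin_dim C + fin_dim B + 2%:E.
Proof.
have [T [u [beta [eu betae betaP betaK]]]] := dualJ.
have [->|[c Cc]] := ge0_nat_or_infty (fin_dim_ge0 C).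
  rewrite addye; last by rewrite gt_eqF // (lt_le_trans _ (fin_dim_ge0 B)) // ltNyr.
  by rewrite leey.
have [->|[b Bb]] := ge0_nat_or_infty (fin_dim_ge0 B).
  by rewrite Cc addey // leey.
have Cc' : fin_dim C <= c%:Z%:E by rewrite Cc.
have Bb' : fin_dim B <= b%:Z%:E by rewrite Bb.
rewrite Cc Bb (_ : _ + _ = (c + b + 2)%N%:Z%:E) //.
apply/fin_dim_leP => d M SM.
apply: (syz_bound psurj (ioP := ioP) pe eu betae betaP betaK _ SM); first exact/fin_dim_leP.
have /fin_dim_leP/(_ d) := Cc'; apply.
exact: (syz_corner ioP pe eu betae betaP betaK SM).
Qed.

End Bounds.

(** * Endomorphism rings *)

Section TwoGenerators.
Context (A B : pzRingType) (p : {rmorphism A -> B}) (e v : A).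

(** If J is the direct sum of Ae and (Ae)v, with right multiplication by v
    injective on Ae, uniqueness makes the two coordinates linear. *)
Lemma unique_dual_basis :
  e * e = e -> e * v = v ->
  (forall y, p y = 0 -> exists a b, [/\ a * e = a, b * e = b & y = a + b * v]) ->
  (forall a b, a * e = a -> b * e = b -> a + b * v = 0 -> a = 0 /\ b = 0) ->
  ideal_dual_basis p e.
Proof.
move=> ee ev ex uniq.
have /choice[beta betaE] y : exists ab : A * A, p y = 0 ->
    [/\ ab.1 * e = ab.1, ab.2 * e = ab.2 & y = ab.1 + ab.2 * v].
  have [py|py] := pselect (p y = 0); last by exists (0, 0).
  by have [a [b ab]] := ex y py; exists (a, b).
exists bool, (fun t => if t then v else e), (fun t y => if t then (beta y).2 else (beta y).1).
split=> [[]//|[] y py|t a x y px py|y py]; try by have [] := betaE y py.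
- have pz : p (a * x + y) = 0 by rewrite rmorphD rmorphM px py mulr0 addr0.
  have [x1 x2 xE] := betaE x px; have [y1 y2 yE] := betaE y py.
  have [z1 z2 zE] := betaE _ pz.
  have [|||E1 E2] := uniq ((beta (a * x + y)).1 - (a * (beta x).1 + (beta y).1))
    ((beta (a * x + y)).2 - (a * (beta x).2 + (beta y).2)).
  + by rewrite mulrBl mulrDl -mulrA z1 x1 y1.
  + by rewrite mulrBl mulrDl -mulrA z2 x2 y2.
  + have E : a * x + y =
        (a * (beta x).1 + (beta y).1) + (a * (beta x).2 + (beta y).2) * v.
      by rewrite {1}xE {1}yE mulrDr mulrDl mulrA addrACA.
    by rewrite mulrBl addrACA -zE -opprD -E subrr.
  + by case: t; apply: subr0_eq.
- have [y1 _ yE] := betaE y py.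
  by rewrite big_bool /= y1 addrC -yE.
Qed.

End TwoGenerators.

Section EndoCorner.
Context (R : pzRingType) (M N : lmodType R).
Context (i : {linear N -> M}) (r : {linear M -> N}) (ri : forall x, r (i x) = x).

Definition endo_embed (c : endo N) : endo M :=
  (i \o ((c : {linear N -> N}) \o r) : {linear M -> M}).

Lemma endo_embedP : corner_embedding endo_embed.
Proof.
split.
- by move=> c d; apply: endo_eq => x /=; rewrite raddfD.
- by move=> c d; apply: endo_eq => x /=; rewrite ri.
- move=> c d cd; apply: endo_eq => x.
  have /(congr1 (fun h : endo M => r ((h : {linear M -> M}) (i x)))) := cd.
  by rewrite /= !ri.
- move=> a; exists (r \o ((a : {linear M -> M}) \o i) : {linear N -> N}).
  by apply: endo_eq => x.
Qed.

End EndoCorner.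

Section RingQuotient.
Context (R : pzRingType) (I : twoSidedIdeal R).
Local Open Scope quotient_scope.

Definition ring_quot_proj (x : R) : ring_quot I := \pi_(Quotient.quot I) x.

Fact ring_quot_proj_zmod : zmod_morphism ring_quot_proj.
Proof. by move=> x y; rewrite /ring_quot_proj (Quotient.pi_add I) (Quotient.pi_opp I). Qed.

Fact ring_quot_proj_monoid : monoid_morphism ring_quot_proj.
Proof. by split=> // x y; rewrite /ring_quot_proj -pi_ring_quot_mul. Qed.

Definition ring_quot_pi : {rmorphism R -> ring_quot I} :=
  HB.pack_for {rmorphism R -> ring_quot I} ring_quot_proj
    (GRing.isZmodMorphism.Build R (ring_quot I) ring_quot_proj ring_quot_proj_zmod)
    (GRing.isMonoidMorphism.Build R (ring_quot I) ring_quot_proj ring_quot_proj_monoid).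

Lemma ring_quot_pi_eq0 x : ring_quot_pi x = 0 <-> x \in I.
Proof.
rewrite -[0](rmorph0 ring_quot_pi); split=> [/eqP|xI].
  by rewrite -[_ == _](Quotient.idealrBE I) subr0.
by apply/eqP; rewrite -[_ == _](Quotient.idealrBE I) subr0.
Qed.

Lemma ring_quot_pi_surj : range ring_quot_pi = setT.
Proof.
apply: lift_surj => z; exists (repr (z : Quotient.quot I)).
by rewrite /= /ring_quot_proj reprK.
Qed.

End RingQuotient.

Lemma make_ideal (R : pzRingType) (S : set R) :
  S 0 -> (forall x y, S x -> S y -> S (x - y)) ->
  (forall a x, S x -> S (a * x)) -> (forall a x, S x -> S (x * a)) ->
  exists J : twoSidedIdeal R, forall x, x \in J <-> S x.
Proof.
move=> S0 SB Sl Sr; pose P : R -> bool := fun x => `[< S x >].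
have PZ : zmod_closed P.
  by split=> [|x y /asboolP Sx /asboolP Sy]; apply/asboolP => //; exact: SB.
have Pl a : {in P, forall u, a * u \in P}.
  by move=> x /asboolP Sx; apply/asboolP; exact: Sl.
have Pr a : {in P, forall u, u * a \in P}.
  by move=> x /asboolP Sx; apply/asboolP; exact: Sr.
exists (HB.pack_for (twoSidedIdeal R) P (GRing.isZmodClosed.Build R P PZ)
  (isTwoSidedIdeal.Build R P Pl Pr)) => x.
by split=> [/asboolP|Sx]; last exact/asboolP.
Qed.

(** * Division rings *)

Section Division.
Context (B : pzRingType) (Binv : forall b : B, b != 0 -> exists c, c * b = 1).
Context (M : lmodType B).

(** Induction on the number of generators: a nontrivial linear relation removes a
    generator, and without one the coordinates are unique, hence linear. *)
Lemma division_fproj : fin_gen M -> fproj M.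
Proof.
move=> [n [v vP]]; apply/dual_basis_fproj.
elim: n v vP => [|n IHn] v vP.
  exists 'I_0, v, (fun _ => \0) => x.
  by have [a ->] := vP x; rewrite !big_ord0.
have [[a [j [av aj]]]|indep] :=
    pselect (exists a j, \sum_(i < n.+1) (a i : B) *: v i = 0 /\ a j != 0).
  have [c caj] := Binv aj.
  apply: (IHn (v \o lift j)) => x; have [b xE] := vP x.
  exists (fun i => b (lift j i) - b j * c * a (lift j i)).
  have -> : x = \sum_i b i *: v i - (b j * c) *: (\sum_i a i *: v i).
    by rewrite av scaler0 subr0.
  rewrite !(bigD1_ord j) //= scalerDr scalerA -mulrA caj mulr1 opprD addrACA subrr add0r.
  rewrite scaler_sumr -sumrB; apply: eq_bigr => i _.
  by rewrite scalerA scalerBl.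
have uniq (a b : 'I_n.+1 -> B) :
    \sum_i a i *: v i = \sum_i b i *: v i -> a = b.
  move=> ab; apply/funext => j; apply/eqP; rewrite -subr_eq0; apply/negPn/negP => abj.
  apply: indep; exists (fun i => a i - b i), j; split=> //.
  under eq_bigr do rewrite scalerBl.
  by rewrite sumrB ab subrr.
have [s sP] := choice vP.
have slin i a x y : (s (a *: x + y) i : B^o) = a *: (s x i : B^o) + s y i.
  have -> // : s (a *: x + y) = fun i => a * s x i + s y i.
  apply: uniq; rewrite -sP {1}(sP x) {1}(sP y) scaler_sumr -big_split.
  by apply: eq_bigr => k _; rewrite scalerDl scalerA.
by exists 'I_n.+1, v, (fun i => to_linear (slin i)).
Qed.

End Division.

Lemma division_fin_dim (B : pzRingType) :
  (forall b : B, b != 0 -> exists c, c * b = 1) -> (fin_dim B <= 0%:Z%:E)%E.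
Proof.
move=> Binv; apply/fin_dim_leP => d M SM; apply: division_fproj => //.
case: d SM => [[]//|d] [K [P [i [q [[_ [n [v vP]]] iq _]]]]].
exists n, (q \o v) => x; have [y <-] := short_exact_surj iq x; have [a ->] := vP y.
by exists a; rewrite linear_sum; apply: eq_bigr => t _; rewrite linearZ.
Qed.

(** * The ring of endomorphisms of the sum of R and an idempotent ideal *)

Section Idempotent.
Context (R : pzRingType) (I : twoSidedIdeal R) (II : idempotent_ideal I).
Local Notation N := (ideal_module I).
Local Notation M := (R^o * N)%type.
Local Notation A := (endo M).

(** Write x in I = I^2 as a sum of products a b with a and b in I; then
    h(a b) = a h(b) lies in I. *)
Lemma hom_ideal (h : {linear N -> R^o}) x : (h x : R) \in I.
Proof.
have : [set` I] (val x) by exact: (valP x).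
rewrite -II => -[n [a [b [aI bI xE]]]].
pose b' i : N := exist (fun x : R^o => x \in I) (b i) (bI i).
have -> : x = \sum_i (a i : R) *: b' i.
  by apply: val_inj; rewrite raddf_sum [LHS]xE.
rewrite linear_sum; apply: rpred_sum => i _.
by rewrite linearZ; apply: two_sided_ideal_mulr.
Qed.

Definition ideal_incl : {linear N -> R^o} := \val.

(** The class modulo I of the component R -> R of an endomorphism; it is
    multiplicative because the composites R -> I -> R are multiplications by
    elements of I. *)
Definition endo_quot (a : A) : ring_quot I :=
  ring_quot_pi I (((a : {linear M -> M}) (1, 0)).1 : R).

Lemma endo_fst (a : A) (z : M) :
  ((a : {linear M -> M}) z).1 - z.1 * ((a : {linear M -> M}) (1, 0)).1 \in I.
Proof.
have zE : z = (z.1 : R) *: pair_inl R^o N 1 + pair_inr R^o N z.2.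
  by case: z => x y; congr pair; rewrite /= ?scaler0 ?add0r // addr0 [RHS]mulr1.
rewrite {1}zE linearP /= addrAC subrr add0r.
exact: (hom_ideal (pair_fst R^o N \o ((a : {linear M -> M}) \o pair_inr R^o N))).
Qed.

Fact endo_quot_zmod : zmod_morphism endo_quot.
Proof. by move=> a b; rewrite /endo_quot -rmorphB. Qed.

Fact endo_quot_monoid : monoid_morphism endo_quot.
Proof.
split=> [|a b]; first exact: (rmorph1 (ring_quot_pi I)).
rewrite /endo_quot -rmorphM; apply/subr0_eq; rewrite -rmorphB.
by apply/ring_quot_pi_eq0; exact: (endo_fst b).
Qed.

Definition endo_quot_morph : {rmorphism A -> ring_quot I} :=
  HB.pack_for {rmorphism A -> ring_quot I} endo_quot
    (GRing.isZmodMorphism.Build A (ring_quot I) endo_quot endo_quot_zmod)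
    (GRing.isMonoidMorphism.Build A (ring_quot I) endo_quot endo_quot_monoid).

Lemma endo_quot_eq0 a : endo_quot a = 0 ->
  forall z, (((a : {linear M -> M}) z).1 : R) \in I.
Proof.
move=> /ring_quot_pi_eq0 aI z; have := endo_fst a z.
by move=> /rpredD/(_ (two_sided_ideal_mull (z.1 : R) _ aI)); rewrite subrK.
Qed.

Lemma endo_quot_surj : range endo_quot_morph = setT.
Proof.
apply: lift_surj => z; have [r <-] := surj_lift (ring_quot_pi_surj I) z.
pose mulr_r (x : R^o) : R^o := (x : R) * r.
have hlin a x y : mulr_r (a *: x + y) = a *: mulr_r x + mulr_r y.
  by rewrite [LHS]mulrDl -[X in X + _]mulrA.
exists (pair_inl R^o N \o (to_linear hlin \o pair_fst R^o N) : {linear M -> M}).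
by congr (ring_quot_pi I _); exact: mul1r.
Qed.

Lemma idempotent_ideal_dual_basis :
  ideal_dual_basis endo_quot_morph (endo_embed (pair_inr R^o N) (pair_snd R^o N) 1).
Proof.
pose e : A := endo_embed (pair_inr R^o N) (pair_snd R^o N) 1.
pose v : A := pair_inl R^o N \o (ideal_incl \o pair_snd R^o N) : {linear M -> M}.
apply: (@unique_dual_basis _ _ _ _ v).
- by apply: endo_eq.
- by apply: endo_eq.
- move=> a /endo_quot_eq0 aI.
  have [|h hE] := @lift_through_mono R N R^o M ideal_incl
      (pair_fst R^o N \o (a : {linear M -> M})) val_inj.
    by move=> z; exists (exist (fun x : R^o => x \in I) _ (aI z)).
  exists (a * e), (pair_inr R^o N \o h : {linear M -> M}); split.
  + by apply: endo_eq.
  + by apply: endo_eq.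
  + apply: endo_eq => z.
    rewrite [LHS]pair_decomp addrC; congr (_ + _).
    exact: (congr1 (pair_inl R^o N) (esym (hE z))).
- move=> a b ae be ab.
  have abz z : ((a : {linear M -> M}) z).2 = 0 /\ ((b : {linear M -> M}) z).2 = 0.
    have := congr1 (fun c : A => (c : {linear M -> M}) z) ab; rewrite -ae.
    case=> /= /eqP; rewrite add0r => /eqP b0 /eqP; rewrite addr0 => /eqP a0.
    by split=> //; exact: val_inj.
  split; apply: endo_eq => z; first by rewrite -ae /=; have [-> _] := abz z.
  by rewrite -be /=; have [_ ->] := abz z.
Qed.

End Idempotent.

(** * The ring of endomorphisms of two terms of an almost split sequence *)

Section AlmostSplit.
Context (R : pzRingType) (Z Y X : lmodType R) (f : {linear Z -> Y}) (g : {linear Y -> X}).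
Context (fg : short_exact f g) (fgY : fin_gen Y) (fgX : fin_gen X).
Context (ras : right_almost_split g) (YZ : forall (h : {linear Y -> Z}) y, h y = 0).
Local Notation M := (Y * X)%type.
Local Notation A := (endo M).

(** The ideal AeA of the projection e onto Y, as a condition that needs no sums: if
    some Y -> X is a split epimorphism then AeA = A, and otherwise all maps Y -> X
    factor through g, so that an X-component factors through a power of Y if and
    only if it factors through g. *)
Definition factors_through : set A :=
  [set a | (exists q : {linear Y -> X}, split_epi q) \/
     exists h : {linear M -> Y}, forall z, ((a : {linear M -> M}) z).2 = g (h z)].

Lemma non_split_factor (W : lmodType R) (h : {linear W -> X}) :
  fin_gen W -> ~ split_epi h -> exists k : {linear W -> Y}, forall w, g (k w) = h w.
Proof. by have [_ ras2] := ras; exact: ras2. Qed.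

Lemma factors_through_ideal :
  exists J : twoSidedIdeal A, forall a, a \in J <-> factors_through a.
Proof.
apply: make_ideal.
- by right; exists \0 => z; exact: (esym (raddf0 g)).
- move=> a b [Ja|[h ah]]; first by left.
  move=> [Jb|[k bk]]; first by left.
  by right; exists (h \- k) => z; rewrite [RHS](linearB g) /= -ah -bk.
- move=> a b [Jb|[k bk]]; first by left.
  by right; exists (k \o (a : {linear M -> M})) => z; rewrite /= -bk.
- move=> a b [Jb|[k bk]]; first by left.
  have [Jq|noq] := pselect (exists q : {linear Y -> X}, split_epi q); first by left.
  pose a1 : {linear Y -> X} := pair_snd Y X \o ((a : {linear M -> M}) \o pair_inl Y X).
  pose a2 : {linear Y -> X} :=
    pair_snd Y X \o ((a : {linear M -> M}) \o (pair_inr Y X \o g)).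
  have [|k1 k1E] := non_split_factor (h := a1) fgY; first by move=> sa; apply: noq; exists a1.
  have [|k2 k2E] := non_split_factor (h := a2) fgY; first by move=> sa; apply: noq; exists a2.
  right; exists ((k1 \o (pair_fst Y X \o (b : {linear M -> M}))) \+ (k2 \o k)) => z.
  rewrite [RHS](linearD g) /= k1E k2E /= -bk.
  by rewrite [X in ((a : {linear M -> M}) X).2]pair_decomp raddfD.
Qed.

Section Ideal.
Context (J : twoSidedIdeal A) (JE : forall a, a \in J <-> factors_through a).

(** If a is not in AeA, its component X -> X does not factor through g, hence is a
    split epimorphism; a section of it is a left inverse of a modulo AeA. *)
Lemma factors_through_division (b : ring_quot J) : b != 0 -> exists c, c * b = 1.
Proof.
have [a <-] := surj_lift (ring_quot_pi_surj J) b.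
have [Ja|nJa] := pselect (factors_through a).
  by have /JE/ring_quot_pi_eq0-> := Ja; rewrite eqxx.
move=> _; have noq : ~ exists q : {linear Y -> X}, split_epi q.
  by move=> q; apply: nJa; left.
pose a1 : {linear Y -> X} := pair_snd Y X \o ((a : {linear M -> M}) \o pair_inl Y X).
pose a2 : {linear X -> X} := pair_snd Y X \o ((a : {linear M -> M}) \o pair_inr Y X).
have [|k1 k1E] := non_split_factor (h := a1) fgY; first by move=> sa; apply: noq; exists a1.
have [[s sE]|ns] := pselect (split_epi a2); last first.
  have [k2 k2E] := non_split_factor (h := a2) fgX ns.
  exfalso; apply: nJa; right.
  exists ((k1 \o pair_fst Y X) \+ (k2 \o pair_snd Y X)) => z.
  by rewrite [RHS](linearD g) /= k1E k2E {1}[z]pair_decomp raddfD.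
pose c : A := pair_inr Y X \o (s \o pair_snd Y X) : {linear M -> M}.
exists (ring_quot_pi J c); rewrite -rmorphM -(rmorph1 (ring_quot_pi J)).
apply/subr0_eq; rewrite -rmorphB; apply/ring_quot_pi_eq0/JE; right.
exists \0 => z; rewrite raddf0.
by rewrite [LHS](_ : _ = a2 (s z.2) - z.2) // sE subrr.
Qed.

(** If q : Y -> X has a section s, then 1 = e e + t u in A, with u given by q and t
    by s.  When no such q exists, u = (e, v) with v given by g.  Uniqueness of the
    coordinates amounts to Hom(Y + X, Z) = 0, and a map X -> Z vanishes because
    its composite with the epimorphism g does. *)
Lemma factors_through_dual_basis :
  ideal_dual_basis (ring_quot_pi J) (endo_embed (pair_inl Y X) (pair_fst Y X) 1).
Proof.
pose e : A := endo_embed (pair_inl Y X) (pair_fst Y X) 1.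
have [[q [s qs]]|noq] := pselect (exists q : {linear Y -> X}, split_epi q).
  pose t : A := pair_inl Y X \o (s \o pair_snd Y X) : {linear M -> M}.
  pose u : A := pair_inr Y X \o (q \o pair_fst Y X) : {linear M -> M}.
  exists bool, (fun k => if k then u else e), (fun k a => a * (if k then t else e)).
  split=> [[]|[] a _|k a x y _ _|a _].
  - by apply: endo_eq.
  - by apply: endo_eq.
  - by apply: endo_eq.
  - by apply: endo_eq.
  - by rewrite mulrDl mulrA.
  - rewrite big_bool /= -!mulrA -mulrDr -[LHS]mulr1; congr (_ * _).
    apply: endo_eq => z; rewrite [LHS]pair_decomp addrC; congr (_ + _).
    by congr pair; rewrite /= qs.
pose v : A := pair_inr Y X \o (g \o pair_fst Y X) : {linear M -> M}.
apply: (@unique_dual_basis _ _ _ _ v).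
- by apply: endo_eq.
- by apply: endo_eq.
- move=> a /ring_quot_pi_eq0/JE[//|[h hE]].
  exists (a * e), (pair_inl Y X \o h : {linear M -> M}); split.
  + by apply: endo_eq.
  + by apply: endo_eq.
  + apply: endo_eq => z; rewrite [LHS]pair_decomp; congr (_ + _).
    exact: (congr1 (pair_inr Y X) (hE z)).
- move=> a b ae be ab.
  have abz z : ((a : {linear M -> M}) z).1 = 0 /\ g ((b : {linear M -> M}) z).1 = 0.
    have := congr1 (fun c : A => (c : {linear M -> M}) z) ab; rewrite -ae.
    by case=> /= /eqP; rewrite addr0 => /eqP -> /eqP; rewrite add0r => /eqP.
  have [finj _ gT] := fg.
  have [|k kE] := @lift_through_mono R Z Y M f (pair_fst Y X \o (b : {linear M -> M})) finj.
    by move=> z; apply: (short_exact_lift fg); have [_] := abz z.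
  have k0 z : k z = 0.
    rewrite [z]pair_decomp raddfD /=; have [y <-] := surj_lift gT z.2.
    rewrite [X in X + _](YZ (k \o pair_inl Y X)) add0r.
    exact: (YZ (k \o (pair_inr Y X \o g))).
  split; apply: endo_eq => z; first by rewrite -ae /=; have [-> _] := abz z.
  by rewrite -be /= -[X in (X, _)](kE z) k0 raddf0.
Qed.

End Ideal.
End AlmostSplit.

(** * Finitistic dimensions of the two endomorphism rings *)

Local Open Scope ereal_scope.

Theorem corollary1p6 :
  (forall (R : pzRingType) (I : twoSidedIdeal R),
     idempotent_ideal I ->
     fin_dim (ring_quot I) <= fin_dim (endo (R^o * ideal_module I)%type) /\
     fin_dim (endo (R^o * ideal_module I)%type)
       <= fin_dim (endo (ideal_module I)) + fin_dim (ring_quot I) + 2%:E)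
  /\
  (forall (R : pzRingType) (Z Y X : lmodType R)
          (f : {linear Z -> Y}) (g : {linear Y -> X}),
     artin_algebra R ->
     almost_split_sequence f g ->
     (forall h : {linear Y -> Z}, forall y, h y = 0%R) ->
     fin_dim (endo (Y * X)%type) <= fin_dim (endo Y) + 2%:E).
Proof.
split=> [R I II|R Z Y X f g _ [[_ fgY fgX] fg _ ras] YZ].
  have ioP := @endo_embedP R _ _ (pair_inr R^o (ideal_module I))
    (pair_snd R^o (ideal_module I)) (fun _ => erefl).
  have pT := endo_quot_surj II.
  have pe : endo_quot_morph II
      (endo_embed (pair_inr R^o (ideal_module I)) (pair_snd R^o (ideal_module I)) 1%R) = 0%R.
    exact: (rmorph0 (ring_quot_pi I)).
  have dualJ := idempotent_ideal_dual_basis II.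
  split; first exact: (fin_dim_quotient_le pT ioP pe dualJ).
  exact: (fin_dim_le_corner_quotient pT ioP pe dualJ).
have [J JE] := factors_through_ideal fgY ras.
have ioP := @endo_embedP R _ _ (pair_inl Y X) (pair_fst Y X) (fun _ => erefl).
have pe : ring_quot_pi J (endo_embed (pair_inl Y X) (pair_fst Y X) 1%R) = 0%R.
  by apply/ring_quot_pi_eq0/JE; right; exists \0 => z; exact: (esym (raddf0 g)).
have dualJ := factors_through_dual_basis fg YZ JE.
have le2 := fin_dim_le_corner_quotient (ring_quot_pi_surj J) ioP pe dualJ.
apply: (le_trans le2); apply: leeD => //.
have B0 := division_fin_dim (factors_through_division fgY fgX ras JE).
by rewrite -[X in _ <= X]adde0; apply: leeD.
Qed.
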